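(* Let $n\ge 3$ and consider the product manifold $(S^1(T)\times S^{n-1},\,g_0=dt^2+d\xi^2)$ of a circle of length $T$ and the standard unit sphere. Under the condition $$T\ \ge\ T_1=\frac{2\pi}{\sqrt{n-2}}$$ on the circle length, every non-trivial pseudo-cylindric metric $g_c=u_c^{\frac{4}{n-2}}g_0$ (i.e. with $u_c$ non-constant) has harmonic Riemannian curvature and non-parallel Ricci tensor. Moreover, any pseudo-cylindric metric may be identified with a Derdzinski metric up to a conformal transformation: for every pseudo-cylindric metric $g_c=u_c^{\frac{4}{n-2}}g_0$ there exist a Derdzinski metric $ds^2+f^2(s)\,d\xi^2$ on the product of a circle and $S^{n-1}$, and a conformal diffeomorphism $F$ (with respect to the product metrics) onto $S^1(T)\times S^{n-1}$, such that $$ds^2+f^2(s)\,d\xi^2=F^*\left(u_c^{\frac{4}{n-2}}(dt^2+d\xi^2)\right).$$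
   Context: $d\xi^2$ is the standard metric of the unit sphere $S^{n-1}$ and $t$ is the arc length coordinate on the circle of length $T$. A pseudo-cylindric metric on $S^1(T)\times S^{n-1}$ is a metric $u^{\frac{4}{n-2}}g_0$, where $u=u(t)$ is a smooth positive $T$-periodic solution of $$u''-\frac{(n-2)^2}{4}u+\frac{n(n-2)}{4}u^{\frac{n+2}{n-2}}=0$$ (equivalently, the metric has constant scalar curvature $n(n-1)$). It is called trivial, or cylindric, if $u$ is constant. The Riemannian curvature $\mathcal R$ of a metric is harmonic if its divergence vanishes, $\delta\mathcal R=0$; equivalently its Ricci tensor is a Codazzi tensor, $D_kR_{ij}=D_iR_{kj}$, where $D$ is the Levi-Civita connection and $R_{ij}$ are the components of the Ricci tensor. The Ricci tensor is parallel if $D\,\mathrm{Ric}=0$, and non-parallel otherwise. A Derdzinski metric on the product of a circle with coordinate $s$ and an $(n-1)$-dimensional Einstein manifold $(N,g_N)$ of positive scalar curvature $R$ is a warped product metric $ds^2+h^{4/n}(s)g_N$, where $h$ is a positive periodic (with the circle length as a period) solution of $$h''-\frac{nR}{4(n-1)}h^{1-4/n}=-\frac n4 C h$$ for some constant $C>0$. Here $N=S^{n-1}$ with $g_N=d\xi^2$, and $f=h^{2/n}$; the case of constant $h$ (trivial Derdzinski metric) is allowed.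
   Formalization: F is conformal from the Derdzinski (warped product) metric ds²+f²dξ² to dt²+dξ²; conformality from the Riemannian product ds²+dξ² would force f=1, which contradicts the constant scalar curvature n(n-1). *)

(* Defs.v *)
From HB Require Import structures.
From mathcomp Require Export all_boot all_order all_algebra.
From mathcomp Require Export all_classical all_reals all_analysis.
Set Implicit Arguments.
Unset Strict Implicit.
Unset Printing Implicit Defensive.
Export Order.TTheory GRing.Theory Num.Theory.
Export numFieldNormedType.Exports.
Local Open Scope classical_set_scope.
Local Open Scope ring_scope.

(* The manifold S^1(T) x S^d is the submanifold of R^2 x R^(d+1) made of the
   pairs (z, y) with |z| = T/(2 pi) and |y| = 1; the Euclidean inner product
   then restricts to dt^2 + dxi^2.  In the theorem d = n - 1.  Tensors are
   expressed in the parametrizations [chart T b] below. *)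

Section Smooth.
Variable R : realType.

Fixpoint Ck (V W : normedModType R) (k : nat) (f : V -> W) : Prop :=
  if k is k'.+1 then
    [/\ continuous f, (forall x v, derivable f x v)
      & forall v, Ck k' (fun x => 'D_v f x)]
  else continuous f.

Definition smooth (V W : normedModType R) (f : V -> W) : Prop :=
  forall k, Ck k f.

End Smooth.

(* Tensor calculus in one coordinate system: [G p] is the matrix of components
   of a metric at the point of coordinates [p].  Lower indices follow the
   upper one in the argument lists. *)
Section Tensors.
Variables (R : realType) (d : nat).
Local Notation coord := 'rV[R]_d.+1.
Local Notation idx := 'I_d.+1.
Implicit Types (i j k l m p : idx) (x : coord).

Definition partial (W : normedModType R) (i : idx) (f : coord -> W) (x : coord)
  : W := 'D_(delta_mx 0 i) f x.

Variable G : coord -> 'M[R]_d.+1.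

(* Gamma^k_{ij} *)
Definition christoffel k i j x : R :=
  2^-1 * \sum_l invmx (G x) k l *
    (partial i (fun y => G y j l) x + partial j (fun y => G y i l) x
     - partial l (fun y => G y i j) x).

(* R^l_{kij}, with R(d_i, d_j) d_k = R^l_{kij} d_l and
   R(X, Y) = D_X D_Y - D_Y D_X - D_[X, Y] *)
Definition riemann l k i j x : R :=
  partial i (christoffel l j k) x - partial j (christoffel l i k) x
  + \sum_m (christoffel l i m x * christoffel m j k x
            - christoffel l j m x * christoffel m i k x).

(* R_{kj} = R^i_{kij}; this sign makes round spheres positive *)
Definition ricci k j x : R := \sum_i riemann i k i j x.

(* D_m R^l_{kij} *)
Definition cov_riemann m l k i j x : R :=
  partial m (riemann l k i j) x
  + \sum_p (christoffel l m p x * riemann p k i j x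
            - christoffel p m k x * riemann l p i j x
            - christoffel p m i x * riemann l k p j x
            - christoffel p m j x * riemann l k i p x).

(* Divergence of the curvature (up to the usual sign): the contraction
   D_l R^l_{kij} = D^l R_{lkij}. *)
Definition div_riemann k i j x : R := \sum_l cov_riemann l l k i j x.

(* D_k R_{ij} *)
Definition cov_ricci k i j x : R :=
  partial k (ricci i j) x
  - \sum_p (christoffel p k i x * ricci p j x
            + christoffel p k j x * ricci i p x).

End Tensors.

Section Product.
Variable R : realType.

Definition dot (m : nat) (v w : 'rV[R]_m) : R := \sum_i v 0 i * w 0 i.

Definition circle_pt (T t : R) : 'rV[R]_2 :=
  \row_i (T / (2 * pi) *
    (if i == 0 then cos (2 * pi * t / T) else sin (2 * pi * t / T))).

Variable d : nat.
Local Notation amb := ('rV[R]_2 * 'rV[R]_d.+1)%type.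

Definition circle_sphere (T : R) : set amb :=
  [set q | dot q.1 q.1 = (T / (2 * pi)) ^+ 2 /\ dot q.2 q.2 = 1].

(* Inverses of the stereographic projections from the two poles
   (+-1, 0, ..., 0). *)
Definition inv_stereo (b : bool) (x : 'rV[R]_d) : 'rV[R]_(1 + d) :=
  (dot x x + 1)^-1 *:
    row_mx ((if b then 1 else -1) * (dot x x - 1))%:M (2 *: x).

(* Coordinates: the arc length t first, then a stereographic coordinate.  Each
   of the two maps is periodic in t; it is a local diffeomorphism, and the two
   images cover the manifold. *)
Definition chart (T : R) (b : bool) (p : 'rV[R]_(1 + d)) : amb :=
  (circle_pt T (lsubmx p 0 0), inv_stereo b (rsubmx p)).

(* Some arc length coordinate of a point of the circle; it is determined up to
   the addition of a multiple of T. *)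
Definition arc (T : R) (z : 'rV[R]_2) : R := xget 0 [set t | circle_pt T t = z].

(* A metric at q is a bilinear form; only its values on vectors tangent to the
   manifold at q matter. *)
Definition metric := amb -> amb -> amb -> R.

(* a(t) dt^2 + b(t) dxi^2, for T-periodic a and b *)
Definition warped_metric (T : R) (a b : R -> R) : metric := fun q v w =>
  a (arc T q.1) * dot v.1 w.1 + b (arc T q.1) * dot v.2 w.2.

Definition product_metric (T : R) : metric :=
  warped_metric T (fun=> 1) (fun=> 1).

(* Components of phi^* g, for a map phi defined on a coordinate space. *)
Definition pullback (phi : 'rV[R]_d.+1 -> amb) (g : metric)
    (p : 'rV[R]_d.+1) : 'M[R]_d.+1 :=
  \matrix_(i, j) g (phi p) (partial i phi p) (partial j phi p).

Definition harmonic_curvature (T : R) (g : metric) : Prop :=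
  forall b k i j p, div_riemann (pullback (chart T b) g) k i j p = 0.

Definition parallel_ricci (T : R) (g : metric) : Prop :=
  forall b k i j p, cov_ricci (pullback (chart T b) g) k i j p = 0.

Definition smooth_on (T : R) (W : normedModType R) (F : amb -> W) : Prop :=
  forall b, smooth (F \o chart T b).

Definition diffeo (S T : R) (F : amb -> amb) : Prop :=
  exists G : amb -> amb,
    [/\ set_fun (circle_sphere S) (circle_sphere T) F,
        set_fun (circle_sphere T) (circle_sphere S) G,
        {in circle_sphere S, cancel F G} /\ {in circle_sphere T, cancel G F},
        smooth_on S F
      & smooth_on T G].

(* g' = F^* g on S^1(S) x S^d *)
Definition is_pullback (S : R) (F : amb -> amb) (g g' : metric) : Prop :=
  forall b p, pullback (chart S b) g' p = pullback (F \o chart S b) g p.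

(* F^* g = lam g' with lam a positive smooth function on S^1(S) x S^d *)
Definition conformal (S : R) (F : amb -> amb) (g' g : metric) : Prop :=
  exists lam : amb -> R,
    [/\ {in circle_sphere S, forall q, 0 < lam q},
        smooth_on S lam
      & is_pullback S F g (fun q v w => lam q * g' q v w)].

End Product.

Section Metrics.
Variables (R : realType) (n : nat).

Definition pseudo_cylindric_sol (T : R) (u : R -> R) : Prop :=
  [/\ smooth u, (forall t, 0 < u t), periodic u T
    & forall t, derive1n 2 u t - (n%:R - 2) ^+ 2 / 4 * u t
        + n%:R * (n%:R - 2) / 4 * u t `^ ((n%:R + 2) / (n%:R - 2)) = 0].

(* u^(4/(n-2)) (dt^2 + dxi^2) *)
Definition conformal_metric (T : R) (u : R -> R) : metric R n.-1 :=
  fun q v w => u (arc T q.1) `^ (4 / (n%:R - 2)) * product_metric T q v w.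

(* The scalar curvature of the fibre, here the unit sphere S^(n-1). *)
Definition sphere_scal : R := (n%:R - 1) * (n%:R - 2).

Definition derdzinski_sol (S : R) (h : R -> R) : Prop :=
  [/\ smooth h, (forall s, 0 < h s), periodic h S
    & exists2 C : R, 0 < C & forall s,
        derive1n 2 h s - n%:R * sphere_scal / (4 * (n%:R - 1)) * h s `^ (1 - 4 / n%:R)
        = - (n%:R / 4 * C * h s)].

(* ds^2 + f^2 dxi^2 with f = h^(2/n) *)
Definition derdzinski_metric (S : R) (h : R -> R) : metric R n.-1 :=
  warped_metric S (fun=> 1) (fun s => (h s `^ (2 / n%:R)) ^+ 2).

End Metrics.

Arguments conformal_metric {R} n T u q v w.
Arguments derdzinski_metric {R} n S h q v w.

(* Main.v *)
Require Import Defs.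
From mathcomp Require Import ring lra.
Set Implicit Arguments.
Unset Strict Implicit.
Unset Printing Implicit Defensive.
Local Open Scope classical_set_scope.
Local Open Scope ring_scope.

(** Write the metric as q (dt^2 + dxi^2) with q = u^(4/(n-2)), and put
    psi = q' / (2 q).  In a stereographic coordinate x the round metric is
    rho^2 dx^2 with rho = 2/(1+|x|^2), and sig_i = d_i log rho satisfies
    d_i sig_j = sig_i sig_j - rho delta_ij and |sig|^2 = 2 rho - rho^2.  These
    two relations and the derivatives of q and psi along t determine all the
    tensors: the connection coefficients, the curvature and its covariant
    derivative are polynomials in psi, psi', psi'', rho, sig_i, dt_i and
    Kronecker symbols, and every tensor identity becomes a polynomial identity
    once the contractions have been evaluated ([sum_lin], [Gam_linear],
    [Gam_upper]).

    A plane has sectional curvature K1 = (1 - psi^2)/q if it is tangent to the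
    sphere, and K2 = - psi'/q if it contains the direction t.  The divergence
    of the curvature turns out to be a multiple of
    K2' + (n-2) psi (K2 - K1) ([div_riemannE]).  The equation for u says that
    2 K2 + (n-2) K1 = n, and K1' = 2 psi (K2 - K1) holds for every psi, so that
    the divergence vanishes ([div_conformal]).

    A mixed component of D Ric is a nonzero multiple of psi (K2 - K1)
    ([cov_ricci_mixed]).  If this product vanished identically, K1 and K2 would
    be constant: either they differ, psi = 0 and u is constant, or they both
    equal 1 and psi' = - q < 0, which contradicts the periodicity of psi
    ([curvature_defect_neq0]).

    For the second part, let s be the arc length of the metric along t, that is
    ds = u^(2/(n-2)) dt, and let S be its increment over a period.  The inverse
    function th is smooth and th (s + S) = th s + T ([periodic_inversion]), so
    that it induces a diffeomorphism of circles, whose product with the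
    identity of the sphere is the map sought.  The function
    h = (u o th)^(n/(n-2)) satisfies h' = n/(n-2) (u' o th), and its equation,
    with C = n, is the equation of u divided by u^(2/(n-2))
    ([hsol_derdzinski]). *)

(** * Directional derivatives and the classes C^k *)

Section DirectionalDerivatives.
Variables (R : realType) (V W : normedModType R).
Implicit Types (f g : V -> R) (x v : V).

(** Restriction to the line x + R v reduces directional derivatives to
    derivatives of functions of one real variable. *)
Lemma is_derive_line (U : normedModType R) (f : V -> U) x v df :
  is_derive x v f df <-> is_derive (0 : R) 1 (fun h : R => f (h *: v + x)) df.
Proof.
have E : (fun h : R => h^-1 *: ((f \o shift x) (h *: v) - f x)) =
    (fun h : R => h^-1 *: (((fun h : R => f (h *: v + x)) \o shift 0) (h *: 1)
      - f (0 *: v + x))).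
  by apply/funext => h /=; rewrite addr0 scale0r add0r [_%:A]mulr1.
by split => -[]; rewrite /derivable/derive ?E => h1 h2; split;
  rewrite /derivable/derive/= ?E //; rewrite -E.
Qed.

Lemma is_derive_add (f g : V -> W) x v df dg :
  is_derive x v f df -> is_derive x v g dg ->
  is_derive x v (fun y => f y + g y) (df + dg).
Proof. exact: is_deriveD. Qed.

Lemma is_derive_opp (f : V -> W) x v df :
  is_derive x v f df -> is_derive x v (fun y => - f y) (- df).
Proof. exact: is_deriveN. Qed.

Lemma is_derive_mul f g x v df dg :
  is_derive x v f df -> is_derive x v g dg ->
  is_derive x v (fun y => f y * g y) (df * g x + f x * dg).
Proof.
move=> hf hg; have := is_deriveM hf hg.
by rewrite /GRing.scale/= addrC (mulrC (g x)).
Qed.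

Lemma is_derive_inv f x v df : f x != 0 ->
  is_derive x v f df -> is_derive x v (fun y => (f y)^-1) (- df / f x ^+ 2).
Proof.
move=> fx0 [h1 h2]; split; first exact: derivableV.
by rewrite deriveV // h2 /GRing.scale/= !mulNr mulrC.
Qed.

Lemma is_derive_const (c : W) x v : is_derive x v (fun=> c) 0.
Proof. exact: is_derive_cst. Qed.

Lemma is_derive_comp (f : R -> R) g x v df dg :
  is_derive (g x) 1 f df -> is_derive x v g dg ->
  is_derive x v (fun y => f (g y)) (df * dg).
Proof.
move=> hf /is_derive_line hg; apply/is_derive_line.
by apply: (is_derive1_comp (f := f)) hg; rewrite scale0r add0r.
Qed.

Lemma is_derive_sum_fun n (F : 'I_n -> V -> W) x v (dF : 'I_n -> W) :
  (forall i, is_derive x v (F i) (dF i)) ->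
  is_derive x v (fun y => \sum_i F i y) (\sum_i dF i).
Proof.
move=> h; rewrite (_ : (fun y => _) = \sum_i F i); first exact: is_derive_sum.
by apply/funext => y; rewrite fct_sumE.
Qed.

End DirectionalDerivatives.

Section SmoothClosure.
Variable R : realType.
Implicit Types V W U : normedModType R.

Lemma Ck_continuous V W k (f : V -> W) : Ck k f -> continuous f.
Proof. by case: k => [|k] //= []. Qed.

Lemma CkS V W k (f : V -> W) (df : V -> V -> W) : continuous f ->
  (forall x v, is_derive x v f (df v x)) -> (forall v, Ck k (df v)) ->
  Ck k.+1 f.
Proof.
move=> cf hf cdf; split => [|x v|v]; [exact: cf | by case: (hf x v) |].
rewrite (_ : (fun x => _) = df v) //; apply/funext => x.
exact: (@derive_val _ _ _ _ _ _ _ (hf x v)).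
Qed.

Lemma CkS_inv V W k (f : V -> W) : Ck k.+1 f ->
  (forall x v, is_derive x v f ('D_v f x)) /\ forall v, Ck k (fun x => 'D_v f x).
Proof. by move=> [_ hf cf]; split => // x v; exact: derivableP. Qed.

Lemma Ck_weaken V W k (f : V -> W) : Ck k.+1 f -> Ck k f.
Proof.
elim: k f => [|k IH] f; first by case.
by move=> [cf hf cdf]; split => // v; apply: IH; exact: cdf.
Qed.

Lemma Ck_cst V W k (c : W) : Ck k (fun _ : V => c).
Proof.
elim: k c => [|k IH] c; first exact: cst_continuous.
by apply: (CkS (df := fun _ _ => 0)) => // x; exact: cst_continuous.
Qed.

Lemma Ck_add V W k (f g : V -> W) : Ck k f -> Ck k g ->
  Ck k (fun x => f x + g x).
Proof.
elim: k f g => [|k IH] f g.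
  by move=> cf cg x; apply: cvgD; [exact: cf | exact: cg].
move=> Cf Cg; have [[hf cf] [hg cg]] := (CkS_inv Cf, CkS_inv Cg).
apply: (CkS (df := fun v x => 'D_v f x + 'D_v g x) _
  (fun x v => is_derive_add (hf x v) (hg x v))) => [|v].
- by move=> x; apply: cvgD; [exact: (Ck_continuous Cf) | exact: (Ck_continuous Cg)].
- by apply: (IH ('D_v f) ('D_v g)).
Qed.

Lemma Ck_sum V W k n (F : 'I_n -> V -> W) : (forall i, Ck k (F i)) ->
  Ck k (fun x => \sum_i F i x).
Proof.
elim: n F => [|n IH] F h.
  rewrite (_ : (fun x => _) = fun=> 0); first exact: Ck_cst.
  by apply/funext => x; rewrite big_ord0.
rewrite (_ : (fun x => _) =
  (fun x => F ord0 x + \sum_(i < n) F (lift ord0 i) x)).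
  by apply: Ck_add => //; apply: IH => i.
by apply/funext => x; rewrite big_ord_recl.
Qed.

Lemma Ck_mul V k (f g : V -> R) : Ck k f -> Ck k g ->
  Ck k (fun x => f x * g x).
Proof.
elim: k f g => [|k IH] f g.
  by move=> cf cg x; apply: cvgM; [exact: cf | exact: cg].
move=> Cf Cg; have [[hf cf] [hg cg]] := (CkS_inv Cf, CkS_inv Cg).
apply: (CkS (df := fun v x => 'D_v f x * g x + f x * 'D_v g x) _
  (fun x v => is_derive_mul (hf x v) (hg x v))) => [|v].
- by move=> x; apply: cvgM; [exact: (Ck_continuous Cf) | exact: (Ck_continuous Cg)].
- apply: Ck_add; first by apply: (IH ('D_v f) g) => //; exact: Ck_weaken.
  by apply: (IH f ('D_v g)) => //; exact: Ck_weaken.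
Qed.

Lemma Ck_opp V k (f : V -> R) : Ck k f -> Ck k (fun x => - f x).
Proof.
move=> /(Ck_mul (Ck_cst _ k (- 1 : R))).
by rewrite (_ : (fun x => _) = (fun x => - f x)) //; apply/funext => x; rewrite mulN1r.
Qed.

Lemma derive1_continuous (f df : R -> R) :
  (forall x : R, is_derive x 1 f (df x)) -> continuous f.
Proof.
move=> hf x; apply/differentiable_continuous/derivable1_diffP.
by case: (hf x).
Qed.

Lemma is_derive_dir (f : R -> R) (x v df : R) :
  is_derive x 1 f df -> is_derive x v f (df * v).
Proof.
move=> hf; apply: (@is_derive_comp _ _ f id) => //; exact: is_derive_id.
Qed.

Lemma Ck_real k (f df : R -> R) : (forall x : R, is_derive x 1 f (df x)) ->
  Ck k df -> Ck k.+1 f.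
Proof.
move=> hf Cdf; apply: (CkS (df := fun v x => df x * v) _
  (fun x v => is_derive_dir v (hf x))) => [|v].
- exact: derive1_continuous hf.
- apply: Ck_mul => //; exact: Ck_cst.
Qed.

(** With a real variable in the middle the chain rule needs no total
    differential, and this is the only composition that occurs below. *)
Lemma Ck_comp V k (f : R -> R) (g : V -> R) : Ck k f -> Ck k g ->
  Ck k (fun x => f (g x)).
Proof.
elim: k f g => [|k IH] f g.
  by move=> cf cg x; apply: continuous_comp; [exact: cg | exact: cf].
move=> Cf Cg; have [[hf cf] [hg cg]] := (CkS_inv Cf, CkS_inv Cg).
apply: (CkS (df := fun v x => 'D_1 f (g x) * 'D_v g x) _
  (fun x v => is_derive_comp (hf (g x) 1) (hg x v))) => [|v].
- by move=> x; apply: continuous_comp;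
    [exact: (Ck_continuous Cg) | exact: (Ck_continuous Cf)].
- apply: Ck_mul => //; apply: (IH (fun y => 'D_1 f y)) => //; exact: Ck_weaken.
Qed.

Lemma is_derive_powR V (f : V -> R) a x v df : 0 < f x ->
  is_derive x v f df ->
  is_derive x v (fun y => f y `^ a) (a * f x `^ (a - 1) * df).
Proof.
move=> f0 hf.
exact: (is_derive_comp (f := @powR R ^~ a) (is_derive1_powR a f0) hf).
Qed.

Lemma powR_continuous_comp V (f : V -> R) a : (forall x, 0 < f x) ->
  continuous f -> continuous (fun x => f x `^ a).
Proof.
move=> f0 cf x; apply: (@continuous_comp _ _ _ f (@powR R ^~ a)); first exact: cf.
apply/differentiable_continuous/derivable1_diffP.
by have [] := is_derive1_powR a (f0 x).
Qed.

(** The induction on k must let the exponent vary, since differentiation lowers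
    it by one. *)
Lemma Ck_powR V k (f : V -> R) a : (forall x, 0 < f x) -> Ck k f ->
  Ck k (fun x => f x `^ a).
Proof.
move=> f0; elim: k a => [|k IH] a Cf; first exact: powR_continuous_comp.
have [hf cf] := CkS_inv Cf.
apply: (CkS (df := fun v x => a * f x `^ (a - 1) * 'D_v f x) _
  (fun x v => is_derive_powR a (f0 x) (hf x v))) => [|v].
- by apply: powR_continuous_comp => //; exact: Ck_continuous Cf.
- apply: Ck_mul => //; apply: Ck_mul; first exact: Ck_cst.
  by apply: (IH (a - 1)); exact: Ck_weaken.
Qed.

Lemma Ck_inv V k (f : V -> R) : (forall x, 0 < f x) -> Ck k f ->
  Ck k (fun x => (f x)^-1).
Proof.
move=> f0 /(Ck_powR (-1) f0); rewrite (_ : (fun x => _) = (fun x => (f x)^-1)) //.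
by apply/funext => x; rewrite powR_inv1 // ltW.
Qed.

Lemma Ck_sin_cos k : Ck k (@sin R) /\ Ck k (@cos R).
Proof.
elim: k => [|k [Cs Cc]]; first by split; [exact: continuous_sin | exact: continuous_cos].
split; first by apply: Ck_real Cc => x; exact: is_derive_sin.
apply: (Ck_real (df := fun x => -1 * sin x)); last by apply: Ck_mul => //; exact: Ck_cst.
by move=> x; rewrite mulN1r; exact: is_derive_cos.
Qed.

Lemma Ck_derive1 k (f : R -> R) : Ck k.+1 f ->
  (forall x : R, is_derive x 1 f (f^`()%classic x)) /\ Ck k (f^`()%classic).
Proof.
move=> /CkS_inv[h C]; split => [x|]; first by rewrite derive1E; exact: h.
by rewrite (_ : f^`()%classic = (fun x => 'D_1 f x)) //; apply/funext => x; rewrite derive1E.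
Qed.

End SmoothClosure.

(** * Index calculus on 'I_d.+1, with index 0 for the circle *)

Section IndexCalculus.
Variables (R : realType) (d : nat).
Local Notation idx := 'I_d.+1.
Implicit Types i j k l m p : idx.

(** The components of dt; [del] below is the Kronecker symbol of the sphere
    directions. *)
Definition tau i : R := (i == ord0)%:R.
Definition kap i j : R := (i == j)%:R.
Definition del i j : R := kap i j - tau i * tau j.

Lemma kapC i j : kap i j = kap j i. Proof. by rewrite /kap eq_sym. Qed.
Lemma kapxx i : kap i i = 1. Proof. by rewrite /kap eqxx. Qed.
Lemma tau0 : tau ord0 = 1. Proof. by rewrite /tau eqxx. Qed.
Lemma kap0r i : kap i ord0 = tau i. Proof. by []. Qed.
Lemma kap0l i : kap ord0 i = tau i. Proof. by rewrite kapC. Qed.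

Lemma sum_kap i (b : idx -> R) : \sum_m kap i m * b m = b i.
Proof.
rewrite (bigD1 i) //= kapxx mul1r big1 ?addr0 // => m /negbTE mi.
by rewrite /kap eq_sym mi mul0r.
Qed.

Lemma sum_tau (b : idx -> R) : \sum_m tau m * b m = b ord0.
Proof. by rewrite -[RHS]sum_kap; apply: eq_bigr => m _; rewrite kap0l. Qed.

Lemma sum_const (c : R) : \sum_(m : idx) c = d.+1%:R * c.
Proof. by rewrite sumr_const card_ord mulr_natl. Qed.

(** Most contractions below have this form: one factor is a
    combination of two Kronecker symbols, of [tau] and of one further covector
    (usually [sig]). *)
Lemma sum_lin u v (a b c e : R) (s f : idx -> R) :
  \sum_p (kap u p * a + kap v p * b + tau p * c + s p * e) * f p =
  a * f u + b * f v + c * f ord0 + e * \sum_p s p * f p.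
Proof.
transitivity (\sum_p (kap u p * (a * f p) + kap v p * (b * f p)
    + tau p * (c * f p) + e * (s p * f p))).
  by apply: eq_bigr => p _; ring.
by rewrite !big_split/= !sum_kap sum_tau -mulr_sumr.
Qed.

End IndexCalculus.

(* Differentiation of polynomial expressions.  The rules are applied without
   type class resolution, which would select the pointwise-operation instances
   of the library and leave the derivative in another form. *)
Ltac der_step :=
  first
  [ match goal with H : _ |- _ => solve [notypeclasses refine (H _ _)
      | notypeclasses refine (H _ _ _) | notypeclasses refine (H _ _ _ _)
      | exact H] end
  | notypeclasses refine (is_derive_const _ _ _)
  | notypeclasses refine (is_derive_add _ _)
  | notypeclasses refine (is_derive_opp _)
  | notypeclasses refine (is_derive_mul _ _) ].
Ltac der := notypeclasses refine (is_derive_eq _ _); [repeat der_step | cbv beta].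

(** * Curvature of q (dt^2 + rho^2 dx^2) *)

Section WarpedTensors.
Variables (R : realType) (d : nat).
Local Notation coord := 'rV[R]_d.+1.
Local Notation idx := 'I_d.+1.
Local Notation e_ i := (delta_mx 0 i : coord).
Local Notation n := (d.+1%:R : R).
Local Notation tau := (@tau R d).
Local Notation kap := (@kap R d).
Local Notation del := (@del R d).
Local Notation kapC := (@kapC R d).
Implicit Types (i j k l m p : idx) (x : coord).

Variables (q psi psi1 psi2 rho : coord -> R) (sig : idx -> coord -> R).
Hypothesis q_neq0 : forall x, q x != 0.
Hypothesis rho_neq0 : forall x, rho x != 0.
Hypothesis sig0 : forall x, sig ord0 x = 0.
Hypothesis sum_sig2 : forall x, \sum_i sig i x * sig i x = 2 * rho x - rho x ^+ 2.
Hypothesis dq : forall x i, is_derive x (e_ i) q (2 * psi x * q x * tau i).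
Hypothesis dpsi : forall x i, is_derive x (e_ i) psi (psi1 x * tau i).
Hypothesis dpsi1 : forall x i, is_derive x (e_ i) psi1 (psi2 x * tau i).
Hypothesis drho : forall x i, is_derive x (e_ i) rho (rho x * sig i x).
Hypothesis dsig : forall x i j,
  is_derive x (e_ i) (sig j) (sig i x * sig j x - rho x * del i j).

(** The components of dt^2 + rho^2 dx^2, the metric before the conformal
    change. *)
Definition base i j x : R := tau i * tau j + rho x * rho x * del i j.

Variable G : coord -> 'M[R]_d.+1.
Hypothesis GE : forall x i j, G x i j = q x * base i j x.

Lemma dbase x m i j :
  is_derive x (e_ m) (fun y => base i j y) (2 * rho x * rho x * sig m x * del i j).
Proof.
by rewrite /base; der; ring.
Qed.

Lemma partial_G x m i j : partial m (fun y => G y i j) x =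
  2 * psi x * tau m * q x * base i j x
  + 2 * q x * rho x * rho x * sig m x * del i j.
Proof.
rewrite /partial (_ : (fun y => G y i j) = (fun y => q y * base i j y)).
  rewrite (@derive_val _ _ _ _ _ _ _ (is_derive_mul (dq x m) (dbase x m i j))).
  by ring.
by apply/funext => y; rewrite GE.
Qed.

Lemma invmx_G x k l : invmx (G x) k l =
  (q x)^-1 * (tau k * tau l + (rho x)^-1 * (rho x)^-1 * del k l).
Proof.
pose H := \matrix_(k, l)
  ((q x)^-1 * (tau k * tau l + (rho x)^-1 * (rho x)^-1 * del k l)) : 'M[R]_d.+1.
have GH : G x *m H = 1%:M.
  apply/matrixP => i j; rewrite !mxE.
  pose f p := H p j.
  (* [sum_lin] asks for two Kronecker symbols and a further covector; the
     superfluous ones get coefficient 0. *)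
  transitivity (\sum_p (kap i p * (q x * rho x ^+ 2) + kap i p * 0
     + tau p * (q x * tau i * (1 - rho x ^+ 2)) + 0 * 0) * f p).
    apply: eq_bigr => p _; rewrite GE /base /del /f.
    by ring.
  rewrite (sum_lin _ _ _ _ _ _ (fun=> 0)) /f !mxE /del kap0l tau0 -/(kap i j).
  have := q_neq0 x; have := rho_neq0 x; move: (kap i j) (tau i) (tau j) => K ti tj.
  by move=> r0 q0; field; rewrite r0 q0.
have [uG _] := mulmx1_unit GH.
by rewrite -(mulmx1 (invmx _)) -GH mulKmx // mxE.
Qed.

(** The connection of rho^2 dx^2 on the sphere indices, plus the effect of the
    conformal factor, whose logarithmic differential is 2 psi dt. *)
Definition Gam k i j x : R :=
  del j k * sig i x + del i k * sig j x - del i j * sig k x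
  + psi x * (del k i * tau j + del k j * tau i - rho x * rho x * del i j * tau k
             + tau i * tau j * tau k).

Lemma christoffelE k i j x : christoffel G k i j x = Gam k i j x.
Proof.
rewrite /christoffel.
pose X l := 2 * psi x * tau i * q x * base j l x
  + 2 * q x * rho x * rho x * sig i x * del j l
  + (2 * psi x * tau j * q x * base i l x
  + 2 * q x * rho x * rho x * sig j x * del i l)
  - (2 * psi x * tau l * q x * base i j x
  + 2 * q x * rho x * rho x * sig l x * del i j).
transitivity (2^-1 * \sum_l (kap k l * ((q x)^-1 * (rho x)^-1 ^+ 2) + kap k l * 0
    + tau l * ((q x)^-1 * tau k * (1 - (rho x)^-1 ^+ 2)) + 0 * 0) * X l).
  congr (_ * _); apply: eq_bigr => l _; rewrite !partial_G invmx_G.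
  by rewrite /X /del -[RHS]mulrC -[LHS]mulrC; congr (_ * _); ring.
rewrite (sum_lin _ _ _ _ _ _ (fun=> 0)) /X /Gam /base /del.
rewrite !kap0r !tau0 sig0 (kapC k i) (kapC k j).
have := q_neq0 x; have := rho_neq0 x => r0 q0.
by field; rewrite r0 q0.
Qed.

Lemma christoffel_fun k i j : christoffel G k i j = (fun x => Gam k i j x).
Proof. by apply/funext => x; rewrite christoffelE. Qed.

(** [Gam_linear] and [Gam_upper] evaluate the contractions of the connection
    with an arbitrary family b, in its last lower and in its upper index; the
    only sum that survives is the contraction of b with [sig]. *)
Lemma Gam_linear l i x (b : idx -> R) : \sum_m Gam l i m x * b m =
  (b l - tau l * b ord0) * sig i x + del i l * (\sum_m sig m x * b m)
  - (b i - tau i * b ord0) * sig l x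
  + psi x * (del l i * b ord0 + (b l - tau l * b ord0) * tau i
    - rho x * rho x * (b i - tau i * b ord0) * tau l
    + tau i * tau l * b ord0).
Proof.
transitivity (\sum_m (kap l m * (sig i x + psi x * tau i)
    + kap i m * (- sig l x - psi x * rho x * rho x * tau l)
    + tau m * (- tau l * sig i x + tau i * sig l x + psi x * (del l i
        - tau l * tau i + rho x * rho x * tau i * tau l + tau i * tau l))
    + sig m x * del i l) * b m).
  apply: eq_bigr => m _; congr (_ * _); rewrite /Gam /del (kapC m l).
  by ring.
by rewrite (sum_lin _ _ _ _ _ _ (sig^~ x)) /del; ring.
Qed.

Lemma Gam_upper i j x (b : idx -> R) : \sum_p Gam p i j x * b p =
  (b j - tau j * b ord0) * sig i x + (b i - tau i * b ord0) * sig j x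
  - del i j * (\sum_p sig p x * b p)
  + psi x * ((b i - tau i * b ord0) * tau j + (b j - tau j * b ord0) * tau i
      - rho x * rho x * del i j * b ord0 + tau i * tau j * b ord0).
Proof.
transitivity (\sum_p (kap i p * (sig j x + psi x * tau j)
    + kap j p * (sig i x + psi x * tau i)
    + tau p * (- tau j * sig i x - tau i * sig j x + psi x * (- tau i * tau j
        - tau j * tau i - rho x * rho x * del i j + tau i * tau j))
    + sig p x * (- del i j)) * b p).
  apply: eq_bigr => p _; congr (_ * _); rewrite /Gam /del (kapC p i) (kapC p j).
  by ring.
by rewrite (sum_lin _ _ _ _ _ _ (sig^~ x)) /del; ring.
Qed.

Lemma sig_lin x u v (a b c : R) :
  \sum_p sig p x * (kap u p * a + kap v p * b + tau p * c) =
  a * sig u x + b * sig v x.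
Proof.
transitivity (\sum_p (kap u p * a + kap v p * b + tau p * c + 0 * 0) * sig p x).
  by apply: eq_bigr => p _; ring.
by rewrite (sum_lin _ _ _ _ _ _ (fun=> 0)) sig0; ring.
Qed.

Lemma dGam x m k i j : is_derive x (e_ m) (fun y => Gam k i j y)
  (del j k * (sig m x * sig i x - rho x * del m i)
   + del i k * (sig m x * sig j x - rho x * del m j)
   - del i j * (sig m x * sig k x - rho x * del m k)
   + psi1 x * tau m * (del k i * tau j + del k j * tau i
       - rho x * rho x * del i j * tau k + tau i * tau j * tau k)
   - psi x * (2 * rho x * rho x * sig m x * del i j * tau k)).
Proof. by rewrite /Gam; der; ring. Qed.

(** With K1 and K2 the two sectional curvatures, the first coefficient is q K1,
    and the second, psi^2 - 1 - psi1, is q (K2 - K1). *)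
Definition Rm l k i j x : R :=
  (1 - psi x * psi x) * (kap l i * base k j x - kap l j * base k i x)
  + (psi x * psi x - 1 - psi1 x) *
    (tau k * tau j * kap l i - tau k * tau i * kap l j
     + tau l * (tau i * base k j x - tau j * base k i x)).

(** The value of the sum of the squares of [sig] enters through the contraction
    of [sig] with the connection: it is what gives the sphere constant
    curvature 1. *)
Lemma riemannE l k i j x : riemann G l k i j x = Rm l k i j x.
Proof.
rewrite /riemann /partial !christoffel_fun.
rewrite !(@derive_val _ _ _ _ _ _ _ (dGam _ _ _ _ _)).
under eq_bigr do rewrite !christoffelE.
rewrite sumrB !Gam_linear.
have S u v : \sum_m sig m x * Gam m u v x = 2 * sig u x * sig v x
    - del u v * (2 * rho x - rho x ^+ 2)
    + psi x * (sig u x * tau v + sig v x * tau u).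
  under eq_bigr do rewrite mulrC.
  by rewrite Gam_upper sum_sig2 sig0; ring.
rewrite !S /Gam /Rm /base /del !kap0r !kap0l !tau0 !sig0.
rewrite ?(kapC i l) ?(kapC j l) ?(kapC k l) ?(kapC k j) ?(kapC k i) ?(kapC j i).
by ring.
Qed.

Lemma riemann_fun l k i j : riemann G l k i j = (fun x => Rm l k i j x).
Proof. by apply/funext => x; rewrite riemannE. Qed.

Lemma dRm x m l k i j : is_derive x (e_ m) (fun y => Rm l k i j y)
  (- 2 * psi x * psi1 x * tau m * (kap l i * base k j x - kap l j * base k i x)
   + (1 - psi x * psi x) * 2 * rho x * rho x * sig m x
     * (kap l i * del k j - kap l j * del k i)
   + (2 * psi x * psi1 x - psi2 x) * tau m *
    (tau k * tau j * kap l i - tau k * tau i * kap l j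
     + tau l * (tau i * base k j x - tau j * base k i x))
   + (psi x * psi x - 1 - psi1 x) * 2 * rho x * rho x * sig m x
     * tau l * (tau i * del k j - tau j * del k i)).
Proof. by rewrite /Rm /base; der; ring. Qed.

(** The covariant derivative of dt. *)
Definition Dtau m k x : R := - psi x * (2 * tau m * tau k - base m k x).

(** What the Leibniz rule gives for [Rm], since base = G / q and G is parallel:
    D base = - 2 psi dt (x) base, D dt = [Dtau], and D_m of the coordinate
    vector of t is psi times the coordinate vector of m. *)
Definition covRm m l k i j x : R :=
  - 2 * psi x * (psi1 x + 1 - psi x * psi x) * tau m
    * (kap l i * base k j x - kap l j * base k i x)
  + (2 * psi x * psi1 x - psi2 x) * tau m *
    (tau k * tau j * kap l i - tau k * tau i * kap l j
     + tau l * (tau i * base k j x - tau j * base k i x))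
  + (psi x * psi x - 1 - psi1 x) *
    ((Dtau m k x * tau j + tau k * Dtau m j x) * kap l i
     - (Dtau m k x * tau i + tau k * Dtau m i x) * kap l j
     + psi x * kap l m * (tau i * base k j x - tau j * base k i x)
     + tau l * (Dtau m i x * base k j x - Dtau m j x * base k i x)
     - 2 * psi x * tau m * tau l * (tau i * base k j x - tau j * base k i x)).

(** The contractions of [sig] with each index of [Rm] are what
    [Gam_linear] and [Gam_upper] leave in the covariant derivative; the fourth
    one follows from the third by antisymmetry. *)
Lemma sig_Rm1 k i j x : \sum_p sig p x * Rm p k i j x =
  ((1 - psi x * psi x) * base k j x
    + (psi x * psi x - 1 - psi1 x) * tau k * tau j) * sig i x
  - ((1 - psi x * psi x) * base k i x
    + (psi x * psi x - 1 - psi1 x) * tau k * tau i) * sig j x.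
Proof.
rewrite -[X in _ + X]mulNr -(sig_lin _ _ _ _ _ ((psi x * psi x - 1 - psi1 x) *
  (tau i * base k j x - tau j * base k i x))).
apply: eq_bigr => p _; congr (_ * _).
by rewrite /Rm (kapC p i) (kapC p j); ring.
Qed.

Lemma sig_Rm2 l i j x : \sum_p sig p x * Rm l p i j x =
  rho x * rho x * ((1 - psi x * psi x) * (kap l i * sig j x - kap l j * sig i x)
   + (psi x * psi x - 1 - psi1 x) * tau l * (tau i * sig j x - tau j * sig i x)).
Proof.
have := sig_lin x i j
 (- rho x * rho x * ((1 - psi x * psi x) * kap l j +
      (psi x * psi x - 1 - psi1 x) * tau l * tau j))
 (rho x * rho x * ((1 - psi x * psi x) * kap l i +
      (psi x * psi x - 1 - psi1 x) * tau l * tau i))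
 ((1 - rho x * rho x) * ((1 - psi x * psi x) * (kap l i * tau j - kap l j * tau i)
   + (psi x * psi x - 1 - psi1 x) * (tau l * (tau i * tau j - tau j * tau i)))
   + (psi x * psi x - 1 - psi1 x) * (tau j * kap l i - tau i * kap l j)).
set L := \sum_(_ < _) _ => h; transitivity L; last by rewrite h; ring.
apply: eq_bigr => p _; congr (_ * _).
by rewrite /Rm /base /del (kapC p i) (kapC p j); ring.
Qed.

Lemma sig_Rm3 l k j x : \sum_p sig p x * Rm l k p j x =
  (1 - psi x * psi x) * (sig l x * base k j x - kap l j * rho x * rho x * sig k x)
   + (psi x * psi x - 1 - psi1 x) * (tau k * tau j * sig l x
      - tau l * tau j * rho x * rho x * sig k x).
Proof.
have := sig_lin x l k
 ((1 - psi x * psi x) * base k j x + (psi x * psi x - 1 - psi1 x) * tau k * tau j)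
 (- rho x * rho x * ((1 - psi x * psi x) * kap l j +
      (psi x * psi x - 1 - psi1 x) * tau l * tau j))
 (- (1 - psi x * psi x) * kap l j * tau k * (1 - rho x * rho x)
  + (psi x * psi x - 1 - psi1 x) * (- tau k * kap l j + tau l * base k j x
     - tau l * tau j * tau k * (1 - rho x * rho x))).
set L := \sum_(_ < _) _ => h; transitivity L; last by rewrite h; ring.
apply: eq_bigr => p _; congr (_ * _).
by rewrite /Rm /base /del; ring.
Qed.

Lemma Rm_antisym l k i j x : Rm l k i j x = - Rm l k j i x.
Proof. by rewrite /Rm; ring. Qed.

Lemma cov_riemannE m l k i j x : cov_riemann G m l k i j x = covRm m l k i j x.
Proof.
rewrite /cov_riemann /partial riemann_fun.
rewrite !(@derive_val _ _ _ _ _ _ _ (dRm _ _ _ _ _ _)).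
under eq_bigr do rewrite !christoffelE !riemannE.
rewrite !sumrB.
rewrite Gam_linear !Gam_upper sig_Rm1 sig_Rm2 sig_Rm3.
have -> : \sum_p sig p x * Rm l k i p x = - (\sum_p sig p x * Rm l k p i x).
  by rewrite -sumrN; apply: eq_bigr => p _; rewrite Rm_antisym mulrN.
rewrite sig_Rm3 /covRm /Dtau /Rm /base /del !kap0r !kap0l !tau0.
rewrite ?(kapC i l) ?(kapC j l) ?(kapC k l) ?(kapC k j) ?(kapC k i) ?(kapC j i).
rewrite ?(kapC m l) ?(kapC m k) ?(kapC m i) ?(kapC m j).
by ring.
Qed.

(** The first factor is q (K2' + (n-2) psi (K2 - K1)). *)
Lemma div_riemannE k i j x : div_riemann G k i j x =
  (2 * psi x * psi1 x - psi2 x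
    + (n - 2) * psi x * (psi x * psi x - 1 - psi1 x))
  * (tau i * base k j x - tau j * base k i x).
Proof.
rewrite /div_riemann.
pose E := psi x * psi x - 1 - psi1 x.
pose a := - 2 * psi x * (psi1 x + 1 - psi x * psi x).
pose b := 2 * psi x * psi1 x - psi2 x.
pose H l := a * tau l * base k j x + b * tau l * tau k * tau j
  + E * (Dtau l k x * tau j + tau k * Dtau l j x).
pose K l := - (a * tau l * base k i x + b * tau l * tau k * tau i
  + E * (Dtau l k x * tau i + tau k * Dtau l i x)).
pose F l := b * tau l * (tau i * base k j x - tau j * base k i x)
  + E * (Dtau l i x * base k j x - Dtau l j x * base k i x
     - 2 * psi x * tau l * (tau i * base k j x - tau j * base k i x)).
transitivity (\sum_l (E * psi x * (tau i * base k j x - tau j * base k i x)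
    + tau l * F l + kap i l * H l + kap j l * K l)).
  apply: eq_bigr => l _; rewrite cov_riemannE /covRm kapxx.
  rewrite (kapC l i) (kapC l j) /F /H /K /a /b /E.
  by ring.
rewrite !big_split/= !sum_kap sum_tau !sum_const.
rewrite /F /H /K /Dtau /a /b /E /base /del ?kap0r ?kap0l ?tau0.
rewrite ?(kapC k j) ?(kapC k i) ?(kapC j i).
by ring.
Qed.

Definition Ric k j x : R :=
  ((n - 1) * (1 - psi x * psi x) + (psi x * psi x - 1 - psi1 x)) * base k j x
  + (n - 2) * (psi x * psi x - 1 - psi1 x) * (tau k * tau j).

Lemma ricciE k j x : ricci G k j x = Ric k j x.
Proof.
rewrite /ricci.
pose a := 1 - psi x * psi x; pose e := psi x * psi x - 1 - psi1 x.
transitivity (\sum_i ((a * base k j x + e * (tau k * tau j))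
    + tau i * (e * (tau i * base k j x - tau j * base k i x) - e * (tau k * kap i j))
    + kap j i * (- a * base k i x) + kap j i * 0)).
  apply: eq_bigr => i _; rewrite riemannE /Rm kapxx (kapC i j) /a /e.
  by ring.
rewrite !big_split/= !sum_kap sum_tau !sum_const.
rewrite /Ric /a /e /base /del !kap0r !kap0l !tau0.
by ring.
Qed.

(** Ric has no mixed component, so that only the connection contributes: the
    second fundamental form of the spheres, times the difference of the two
    eigenvalues of Ric. *)
Lemma cov_ricci_mixed k x : k != ord0 -> cov_ricci G k k ord0 x =
  (n - 2) * psi x * (psi x * psi x - 1 - psi1 x) * rho x ^+ 2.
Proof.
move=> k0; have tk : tau k = 0 by rewrite /tau (negbTE k0).
rewrite /cov_ricci /partial.
have -> : ricci G k ord0 = (fun=> 0).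
  apply/funext => y; rewrite ricciE /Ric /base /del kap0r tk.
  by ring.
rewrite derive_cst sub0r big_split/=.
under eq_bigr do rewrite christoffelE ricciE.
rewrite [X in _ + X](eq_bigr (fun p => Gam p k ord0 x * Ric k p x)); last first.
  by move=> p _; rewrite christoffelE ricciE.
rewrite !Gam_upper.
have S p : sig p x * Ric p ord0 x = 0.
  rewrite /Ric /base /del kap0r tau0.
  have -> : sig p x * (((n - 1) * (1 - psi x * psi x) + (psi x * psi x - 1 - psi1 x)) *
  (tau p * 1 + rho x * rho x * (tau p - tau p * 1)) +
  (n - 2) * (psi x * psi x - 1 - psi1 x) * (tau p * 1)) =
    tau p * sig p x * ((n - 1) * (1 - psi x * psi x) + (psi x * psi x - 1 - psi1 x) + (n - 2) * (psi x * psi x - 1 - psi1 x)) by ring.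
  by rewrite /tau; case: eqP => [->|_] /=; rewrite ?sig0 ?mulr0 !mul0r.
rewrite big1 // /Ric /base /del ?kap0r ?kap0l ?tau0 ?sig0 kapxx tk.
by ring.
Qed.

End WarpedTensors.

(** * The circle and its arc length coordinate *)

Section Circle.
Variable R : realType.
Implicit Types (T t a b : R) (z : 'rV[R]_2).

Lemma periodic_int (f : R -> R) T a (k : int) :
  periodic f T -> f (a + k%:~R * T) = f a.
Proof.
move=> fT; case: k => m; first by rewrite -pmulrn mulr_natl periodicn.
rewrite NegzE mulrNz mulNr -pmulrn mulr_natl.
by rewrite -(periodicn fT m.+1) subrK.
Qed.

(** Reduce a modulo 2 pi to [0, 2 pi[, where cos takes the value 1 at 0 only. *)
Lemma cos_eq1 a : cos a = 1 -> exists k : int, a = k%:~R * (2 * pi).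
Proof.
move=> ca; have pi0 := pi_gt0 R.
pose k := Num.floor (a / (2 * pi)); exists k.
pose r := a - k%:~R * (2 * pi).
have pp : 0 < 2 * pi :> R by rewrite mulr_gt0.
have r0 : 0 <= r.
  by rewrite subr_ge0 -ler_pdivlMr // floor_le_tmp.
have r1 : r < 2 * pi.
  rewrite ltrBlDl -[X in _ < _ + X]mul1r -mulrDl -ltr_pdivrMr //.
  by rewrite -[1]/(1%:~R) -intrD floorD1_gt.
have cr : cos r = 1.
  have per : periodic (@cos R) (2 * pi) by move=> x; rewrite mulr_natl cosD2pi.
  by rewrite -(periodic_int r k per) /r subrK.
suff : r = 0 by move=> /eqP; rewrite subr_eq0 => /eqP.
have [rpi|rpi] := leP r pi.
  apply: cos_inj; rewrite ?cos0 //; first by rewrite in_itv/= r0.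
  by rewrite in_itv/= lexx ltW.
have : 2 * pi - r = 0.
  apply: cos_inj; rewrite ?in_itv/= ?lexx ?(ltW pi0) //; first by lra.
  by rewrite addrC mulr_natl cosD2pi cosN cr cos0.
by lra.
Qed.

Lemma dot_circle z : dot z z = z 0 0 ^+ 2 + z 0 1 ^+ 2.
Proof. by rewrite /dot big_ord_recl big_ord1 -!expr2; congr (_ + z 0 _ ^+ 2); apply/val_inj. Qed.

Variable T : R.
Hypothesis T0 : 0 < T.

Let pi0 : 0 < pi :> R := pi_gt0 R.
Let T1 : T != 0. Proof. by rewrite gt_eqF. Qed.
Let p1 : pi != 0 :> R. Proof. by rewrite gt_eqF. Qed.

Lemma circle_pt_inj a b : circle_pt T a = circle_pt T b ->
  exists k : int, a = b + k%:~R * T.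
Proof.
move=> /rowP E.
have nz : T / (2 * pi) != 0 by rewrite mulf_neq0 ?invr_neq0 ?mulf_neq0 ?gt_eqF.
have := E 0; rewrite !mxE/= => /(mulfI nz) Ec.
have := E 1; rewrite !mxE/= => /(mulfI nz) Es.
have [k hk] : exists k : int, 2 * pi * a / T - 2 * pi * b / T = k%:~R * (2 * pi).
  by apply: cos_eq1; rewrite cosB Ec Es -!expr2 cos2Dsin2.
exists k; apply/eqP; rewrite addrC -subr_eq; apply/eqP.
have : (2 * pi * a / T - 2 * pi * b / T) * (T / (2 * pi)) = k%:~R * (2 * pi) * (T / (2 * pi)).
  by rewrite hk.
have -> : k%:~R * (2 * pi) * (T / (2 * pi)) = k%:~R * T.
  by move: (pi : R) p1 => p pn; field; rewrite ?T1 ?pn.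
by move=> <-; move: (pi : R) p1 => p pn; field; rewrite ?T1 ?pn.
Qed.

Lemma circle_pt_periodic a (k : int) :
  circle_pt T (a + k%:~R * T) = circle_pt T a.
Proof.
have E : 2 * pi * (a + k%:~R * T) / T = 2 * pi * a / T + k%:~R * (2 * pi).
  by move: (pi : R) p1 => p pn; field; rewrite ?T1 ?pn.
apply/rowP => i; rewrite !mxE E; congr (_ * _).
by case: eqP => _; apply: periodic_int => x; rewrite mulr_natl ?cosD2pi ?sinD2pi.
Qed.

Lemma dot_circle_pt t : dot (circle_pt T t) (circle_pt T t) = (T / (2 * pi)) ^+ 2.
Proof. by rewrite dot_circle !mxE/= !exprMn -mulrDr cos2Dsin2 mulr1. Qed.

Lemma circle_pt_surj z : dot z z = (T / (2 * pi)) ^+ 2 ->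
  exists t, circle_pt T t = z.
Proof.
rewrite dot_circle => zz.
pose r := T / (2 * pi); have r0 : 0 < r by rewrite divr_gt0 ?mulr_gt0.
pose c := z 0 0 / r; pose s := z 0 1 / r.
have cs : c ^+ 2 + s ^+ 2 = 1.
  by rewrite /c /s !exprMn -mulrDl zz exprVn divff // expf_neq0 ?gt_eqF.
have c1 : -1 <= c <= 1.
  by move: c s cs => c s cs; apply/andP; split; nra.
have [al [ca sa]] : exists al, cos al = c /\ sin al = s.
  have sq : sin (acos c) = `|s|.
    by rewrite sin_acos // -sqrtr_sqr; congr Num.sqrt; lra.
  have ck : cos (acos c) = c by apply: acosK; rewrite in_itv.
  have [s0|s0] := leP 0 s.
    by exists (acos c); rewrite sq ger0_norm.
  by exists (- acos c); rewrite cosN sinN sq ltr0_norm // opprK.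
exists (al * r); apply/rowP => i; rewrite !mxE.
have -> : 2 * pi * (al * r) / T = al by rewrite /r; move: (pi : R) p1 => p pn; field; rewrite ?T1 ?pn.
rewrite ca sa -/r; case: ifP => [/eqP ->|i0].
  by rewrite /c mulrC divfK // gt_eqF.
have -> : i = 1 by apply/val_inj; case: i i0 => -[|[|]].
by rewrite /s mulrC divfK // gt_eqF.
Qed.

Lemma arcK z : dot z z = (T / (2 * pi)) ^+ 2 -> circle_pt T (arc T z) = z.
Proof.
move=> /circle_pt_surj[t tz]; rewrite /arc.
by case: xgetP => [x _ //|/(_ t)]; rewrite /= tz.
Qed.

Lemma arc_circle_pt t : exists k : int, arc T (circle_pt T t) = t + k%:~R * T.
Proof. by apply: circle_pt_inj; apply: arcK; exact: dot_circle_pt. Qed.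

Lemma periodic_arc (f : R -> R) t : periodic f T -> f (arc T (circle_pt T t)) = f t.
Proof. by move=> fT; have [k ->] := arc_circle_pt t; exact: periodic_int. Qed.

Definition circle_tan (t : R) : 'rV[R]_2 :=
  \row_i (if i == 0 then - sin (2 * pi * t / T) else cos (2 * pi * t / T)).

Lemma dot_circle_tan t : dot (circle_tan t) (circle_tan t) = 1.
Proof. by rewrite dot_circle !mxE/= sqrrN addrC cos2Dsin2. Qed.

End Circle.

(** * Pairs and row vectors *)

Section PairRow.
Variable R : realType.
Implicit Types V W U : normedModType R.

Lemma is_derive_pair V W U (f : V -> W) (g : V -> U) x v df dg :
  is_derive x v f df -> is_derive x v g dg ->
  is_derive x v (fun y => (f y, g y)) (df, dg).
Proof.
move=> [f1 f2] [g1 g2].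
have C : (fun h : R => h^-1 *: (((fun y => (f y, g y)) \o shift x) (h *: v) - (f x, g x)))
    @ 0^' --> (df, dg).
  rewrite -f2 -g2; apply: cvg_pair; [exact: f1 | exact: g1].
by split; [apply/cvg_ex; exists (df, dg) | exact: cvg_lim].
Qed.

Lemma is_derive_row V m (f : 'I_m -> V -> R) x v (df : 'I_m -> R) :
  (forall j, is_derive x v (f j) (df j)) ->
  is_derive x v (fun y => \row_j f j y) (\row_j df j).
Proof.
move=> h; have D : derivable (fun y => \row_j f j y) x v.
  apply/derivable_mxP => i j.
  rewrite (_ : (fun y => _) = f j); first by case: (h j).
  by apply/funext => y; rewrite mxE.
split => //; rewrite derive_mx //; apply/matrixP => i j; rewrite !mxE.
rewrite (_ : (fun y => _) = f j); first by case: (h j).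
by apply/funext => y; rewrite mxE.
Qed.

Lemma Ck_pair V W U k (f : V -> W) (g : V -> U) : Ck k f -> Ck k g ->
  Ck k (fun x => (f x, g x)).
Proof.
elim: k f g => [|k IH] f g.
  by move=> cf cg x; apply: cvg_pair; [exact: cf | exact: cg].
move=> Cf Cg; have [[hf cf] [hg cg]] := (CkS_inv Cf, CkS_inv Cg).
apply: (CkS (df := fun v x => ('D_v f x, 'D_v g x)) _
  (fun x v => is_derive_pair (hf x v) (hg x v))) => [|v].
- by move=> x; apply: cvg_pair; [exact: (Ck_continuous Cf) | exact: (Ck_continuous Cg)].
- by apply: (IH ('D_v f) ('D_v g)).
Qed.

Lemma is_derive_scalec V W (f : V -> R) (c : W) x v df :
  is_derive x v f df -> is_derive x v (fun y => f y *: c) (df *: c).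
Proof.
move=> [f1 f2].
have C : (fun h : R => h^-1 *: (((fun y => f y *: c) \o shift x) (h *: v) - f x *: c))
    @ 0^' --> df *: c.
  have -> : (fun h : R => h^-1 *: (((fun y => f y *: c) \o shift x) (h *: v) - f x *: c)) =
      (fun h : R => (h^-1 *: ((f \o shift x) (h *: v) - f x)) *: c).
    by apply/funext => h /=; rewrite -scalerBl scalerA.
  by apply: cvgZr_tmp; rewrite -f2; exact: f1.
by split; [apply/cvg_ex; exists (df *: c) | exact: cvg_lim].
Qed.

Lemma Ck_scalec V W k (f : V -> R) (c : W) : Ck k f -> Ck k (fun x => f x *: c).
Proof.
elim: k f => [|k IH] f.
  by move=> cf x; apply: cvgZr_tmp; exact: cf.
move=> Cf; have [hf cf] := CkS_inv Cf.
apply: (CkS (df := fun v x => 'D_v f x *: c) _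
  (fun x v => is_derive_scalec c (hf x v))) => [|v].
- by move=> x; apply: cvgZr_tmp; exact: (Ck_continuous Cf).
- by apply: (IH ('D_v f)).
Qed.

Lemma Ck_row V m k (f : 'I_m -> V -> R) : (forall j, Ck k (f j)) ->
  Ck k (fun y => \row_j f j y).
Proof.
move=> h; rewrite (_ : (fun y => _) = (fun y => \sum_j f j y *: delta_mx 0 j)).
  by apply: Ck_sum => j; exact: Ck_scalec.
by apply/funext => y; rewrite [LHS]row_sum_delta; apply: eq_bigr => j _; rewrite mxE.
Qed.

Lemma is_derive_coord m (x v : 'rV[R]_m.+1) j :
  is_derive x v (fun y : 'rV[R]_m.+1 => y 0 j) (v 0 j).
Proof.
apply/is_derive_line.
have -> : (fun h : R => (h *: v + x) 0 j) = (fun h : R => h * v 0 j + x 0 j).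
  by apply/funext => h; rewrite !mxE.
notypeclasses refine (is_derive_eq _ _).
  notypeclasses refine (is_derive_add _ (is_derive_const _ _ _)).
  notypeclasses refine (is_derive_mul (is_derive_id _ _) (is_derive_const _ _ _)).
by rewrite mul1r mulr0 !addr0.
Qed.

Lemma Ck_coord m k j : Ck k (fun y : 'rV[R]_m.+1 => y 0 j).
Proof.
have C : continuous (fun y : 'rV[R]_m.+1 => y 0 j) by move=> x; exact: coord_continuous.
case: k => [|k] //.
apply: (CkS C (fun x v => is_derive_coord x v j)) => v; exact: Ck_cst.
Qed.

End PairRow.

(** * Stereographic charts *)

Section Charts.
Variables (R : realType) (d : nat).
Local Notation coord := 'rV[R]_d.+1.
Local Notation idx := 'I_d.+1.
Local Notation e_ i := (delta_mx 0 i : coord).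
Local Notation tau := (@tau R d).
Local Notation kap := (@kap R d).
Local Notation del := (@del R d).
Local Notation kapC := (@kapC R d).
Implicit Types (i j k : idx) (p : coord).

(** The stereographic coordinates, extended by 0 at the index of t, so that
    sums over the sphere indices can be taken over all indices. *)
Definition fibre j p : R := p 0 j - tau j * p 0 ord0.
Definition stereo_den p : R := 1 + \sum_j fibre j p * fibre j p.
Definition rho p : R := 2 * (stereo_den p)^-1.
Definition sig j p : R := - (rho p * fibre j p).

Lemma fibre0 p : fibre ord0 p = 0.
Proof. by rewrite /fibre tau0 mul1r subrr. Qed.

Lemma stereo_den_gt0 p : 0 < stereo_den p.
Proof. by rewrite ltr_wpDr // sumr_ge0 // => j _; rewrite -expr2 sqr_ge0. Qed.

Lemma stereo_den_neq0 p : stereo_den p != 0.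
Proof. by rewrite gt_eqF // stereo_den_gt0. Qed.

Lemma rho_gt0 p : 0 < rho p.
Proof. by rewrite mulr_gt0 // invr_gt0 stereo_den_gt0. Qed.

Lemma sig0 p : sig ord0 p = 0.
Proof. by rewrite /sig fibre0 mulr0 oppr0. Qed.

Lemma sum_sig2 p : \sum_j sig j p * sig j p = 2 * rho p - rho p ^+ 2.
Proof.
transitivity (rho p ^+ 2 * (stereo_den p - 1)).
  rewrite /stereo_den addrC addKr mulr_sumr; apply: eq_bigr => j _.
  by rewrite /sig; ring.
by rewrite /rho; have := stereo_den_neq0 p; move: (stereo_den p) => s s0; field.
Qed.

Lemma sum_del i (b : idx -> R) : \sum_j del i j * b j = b i - tau i * b ord0.
Proof.
transitivity (\sum_j (kap i j * b j - tau i * (tau j * b j))).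
  by apply: eq_bigr => j _; rewrite /del; ring.
by rewrite sumrB sum_kap -mulr_sumr sum_tau.
Qed.

Lemma del_tau i k : del i k * tau k = 0.
Proof.
have [->|k0] := eqVneq k ord0.
  by rewrite /del kap0r tau0 !mulr1 subrr.
by rewrite [X in _ * X](_ : _ = 0) ?mulr0 // /tau (negbTE k0).
Qed.

Lemma dfibre p i j : is_derive p (e_ i) (fun y => fibre j y) (del i j).
Proof.
rewrite /fibre; notypeclasses refine (is_derive_eq _ _).
  notypeclasses refine (is_derive_add (is_derive_coord _ _ _) (is_derive_opp _)).
  notypeclasses refine (is_derive_mul (is_derive_const _ _ _) (is_derive_coord _ _ _)).
rewrite !mxE/= mul0r add0r /del -/(kap j i) -/(kap ord0 i) kap0l kapC.
by rewrite [tau j * _]mulrC.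
Qed.

Lemma dstereo_den p i :
  is_derive p (e_ i) (fun y => stereo_den y) (2 * fibre i p).
Proof.
rewrite /stereo_den; notypeclasses refine (is_derive_eq _ _).
  notypeclasses refine (is_derive_add (is_derive_const _ _ _)
    (is_derive_sum_fun (fun j => is_derive_mul (dfibre p i j) (dfibre p i j)))).
rewrite add0r big_split/= sum_del fibre0 mulr0 subr0.
under eq_bigr do rewrite mulrC.
by rewrite sum_del fibre0 mulr0 subr0; ring.
Qed.

Lemma drho p i : is_derive p (e_ i) (fun y => rho y) (rho p * sig i p).
Proof.
rewrite /rho; notypeclasses refine (is_derive_eq _ _).
  exact: (is_derive_mul (is_derive_const _ _ _)
    (is_derive_inv (stereo_den_neq0 p) (dstereo_den p i))).
rewrite /sig /rho; have := stereo_den_neq0 p; move: (stereo_den p) => s s0.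
by field.
Qed.

Lemma dsig p i j :
  is_derive p (e_ i) (fun y => sig j y) (sig i p * sig j p - rho p * del i j).
Proof.
rewrite /sig; notypeclasses refine (is_derive_eq _ _).
  exact: (is_derive_opp (is_derive_mul (drho p i) (dfibre p i j))).
by rewrite /sig; ring.
Qed.

Definition pole (b : bool) : R := if b then 1 else -1.

(** [inv_stereo] in a form that is uniform in the component: 1 - rho in the
    direction of the pole and rho x in the others. *)
Definition sphere_pt b p : coord :=
  \row_k (pole b * tau k * (1 - rho p) + rho p * fibre k p).

Lemma chartE T b p : chart T b p = (circle_pt T (p 0 ord0), sphere_pt b p).
Proof.
have rE (i : 'I_d) : rsubmx (p : 'rV_(1 + d)) 0 i = p 0 (lift ord0 i).
  by rewrite mxE; congr (p 0 _); apply/val_inj.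
have l0 : (lshift d (0 : 'I_1) : 'I_(1 + d)) = (ord0 : 'I_d.+1) by apply/val_inj.
rewrite /chart; congr (circle_pt T _, _).
  by rewrite mxE; congr (p 0 _); apply/val_inj.
have dE : dot (rsubmx (p : 'rV_(1 + d))) (rsubmx (p : 'rV_(1 + d))) + 1 = stereo_den p.
  rewrite /stereo_den big_ord_recl fibre0 mul0r add0r addrC; congr (_ + _).
  by apply: eq_bigr => i _; rewrite rE /fibre /tau/= mul0r subr0.
rewrite /inv_stereo dE.
have -> : dot (rsubmx (p : 'rV_(1 + d))) (rsubmx (p : 'rV_(1 + d))) = stereo_den p - 1.
  by rewrite -dE addrK.
apply/rowP => k; rewrite [RHS]mxE [LHS]mxE.
have s0 := stereo_den_neq0 p.
case: (@split_ordP 1 d k) => j ->.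
  rewrite row_mxEl ord1 l0 tau0 fibre0 !mxE/= mulr1n /rho /pole.
  by case: b; move: (stereo_den p) s0 => s s0; field.
rewrite row_mxEr !mxE.
have -> : rshift 1 j = lift ord0 j by apply/val_inj.
rewrite /rho /fibre /tau/=.
by move: (stereo_den p) (p 0 _) s0 => s y s0; field.
Qed.

Lemma dsphere_pt b p i : is_derive p (e_ i) (fun y => sphere_pt b y)
  (\row_k (rho p * del i k - sig i p * sig k p - pole b * tau k * rho p * sig i p)).
Proof.
apply: is_derive_row => k; notypeclasses refine (is_derive_eq _ _).
  notypeclasses refine (is_derive_add (is_derive_mul (is_derive_const _ _ _)
     (is_derive_add (is_derive_const _ _ _) (is_derive_opp (drho p i))))
     (is_derive_mul (drho p i) (dfibre p i k))).
by rewrite /sig; ring.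
Qed.

(** The stereographic projection is conformal with factor [rho]. *)
Lemma dot_dsphere_pt b p i j :
  dot (partial i (sphere_pt b) p) (partial j (sphere_pt b) p)
  = rho p * rho p * del i j.
Proof.
rewrite /partial !(@derive_val _ _ _ _ _ _ _ (dsphere_pt _ _ _)) /dot.
have pb : pole b * pole b = 1 by rewrite /pole; case: b; ring.
have st k : sig k p * tau k = 0.
  by rewrite /tau; case: eqP => [->|_]; rewrite ?sig0 ?mul0r ?mulr0.
transitivity (\sum_k (del i k * (rho p ^+ 2 * del j k - rho p * sig j p * sig k p)
   - (rho p * sig i p) * (del j k * sig k p)
   + (sig i p * sig j p) * (sig k p * sig k p)
   + (rho p ^+ 2 * sig i p * sig j p) * (tau k * tau k))).
  apply: eq_bigr => k _; rewrite !mxE.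
  have -> : (rho p * del i k - sig i p * sig k p - pole b * tau k * rho p * sig i p) *
    (rho p * del j k - sig j p * sig k p - pole b * tau k * rho p * sig j p) =
    del i k * (rho p ^+ 2 * del j k - rho p * sig j p * sig k p)
   - (rho p * sig i p) * (del j k * sig k p)
   + (sig i p * sig j p) * (sig k p * sig k p)
   + (rho p ^+ 2 * sig i p * sig j p) * (pole b * pole b) * (tau k * tau k)
   - pole b * rho p ^+ 2 * sig j p * (del i k * tau k)
   - pole b * rho p ^+ 2 * sig i p * (del j k * tau k)
   + 2 * pole b * rho p * sig i p * sig j p * (sig k p * tau k) by ring.
  by rewrite pb !del_tau st; ring.
rewrite !big_split/= sumrN -!mulr_sumr !sum_del sum_tau sum_sig2 !sig0 tau0.
rewrite /del kap0r tau0 (kapC j i).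
by ring.
Qed.

End Charts.

(** * Pullbacks by reparametrized charts *)

Section Pullback.
Variables (R : realType) (d : nat).
Local Notation coord := 'rV[R]_d.+1.
Local Notation idx := 'I_d.+1.
Local Notation e_ i := (delta_mx 0 i : coord).
Local Notation tau := (@tau R d).
Local Notation del := (@del R d).
Implicit Types (i j k : idx) (p : coord).

Lemma dot_scale m (a b : R) (v w : 'rV[R]_m) :
  dot (a *: v) (b *: w) = a * b * dot v w.
Proof. by rewrite /dot mulr_sumr; apply: eq_bigr => i _; rewrite !mxE; ring. Qed.

Lemma is_derive_circle_coord (T t : R) (i : 'I_2) : 0 < T ->
  is_derive t 1 (fun s => T / (2 * pi) *
    (if i == 0 then cos (2 * pi * s / T) else sin (2 * pi * s / T)))
  (circle_tan T t 0 i).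
Proof.
move=> T0; rewrite mxE.
have T1 : T != 0 by rewrite gt_eqF.
have p1 : (pi : R) != 0 by rewrite gt_eqF // pi_gt0.
have L : is_derive t 1 (fun s => 2 * pi * s / T) (2 * pi / T).
  notypeclasses refine (is_derive_eq _ _).
    notypeclasses refine (is_derive_mul (is_derive_mul (is_derive_const _ _ _)
      (is_derive_id _ _)) (is_derive_const _ _ _)).
  by move: (pi : R) => p; ring.
case: (i == 0).
  notypeclasses refine (is_derive_eq _ _).
    notypeclasses refine (is_derive_mul (is_derive_const _ _ _)
      (is_derive_comp (is_derive_cos _) L)).
  by cbv beta; move: (sin (2 * pi * t / T)) (pi : R) p1 => s p pn; field; rewrite T1.
notypeclasses refine (is_derive_eq _ _).
  notypeclasses refine (is_derive_mul (is_derive_const _ _ _)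
    (is_derive_comp (is_derive_sin _) L)).
by cbv beta; move: (cos (2 * pi * t / T)) (pi : R) p1 => s p pn; field; rewrite T1.
Qed.

Section TimeChange.
Variables (T : R) (b : bool) (th dth : R -> R).
Hypothesis T0 : 0 < T.
Hypothesis dthE : forall t : R, is_derive t 1 th (dth t).

Lemma partial_time_change p i :
  partial i (fun y : coord => (circle_pt T (th (y 0 ord0)), sphere_pt b y)) p =
  ((dth (p 0 ord0) * tau i) *: circle_tan T (th (p 0 ord0)),
   partial i (sphere_pt b) p).
Proof.
have dt : is_derive p (e_ i) (fun y : coord => th (y 0 ord0))
    (dth (p 0 ord0) * tau i).
  notypeclasses refine (is_derive_eq _ _).
    exact: (is_derive_comp (dthE _) (is_derive_coord _ _ _)).
  by rewrite mxE/= -/(kap R ord0 i) kap0l.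
have dc : is_derive p (e_ i) (fun y : coord => circle_pt T (th (y 0 ord0)))
    ((dth (p 0 ord0) * tau i) *: circle_tan T (th (p 0 ord0))).
  notypeclasses refine (is_derive_eq _ _).
    apply: is_derive_row => j.
    exact: (is_derive_comp (is_derive_circle_coord _ j T0) dt).
  by apply/rowP => j; rewrite !mxE mulrC.
have ds := dsphere_pt b p i.
rewrite /partial (@derive_val _ _ _ _ _ _ _ (is_derive_pair dc ds)).
by rewrite (@derive_val _ _ _ _ _ _ _ ds).
Qed.

(** All pullbacks that are needed have this shape: with th = id for the charts
    themselves, and with the inverse of the arc length for the map of the
    second part composed with a chart. *)
Lemma pullback_time_change (g : metric R d) p (a c : R) :
  (forall v w, g (circle_pt T (th (p 0 ord0)), sphere_pt b p) v w =
     a * dot v.1 w.1 + c * dot v.2 w.2) ->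
  pullback (fun y : coord => (circle_pt T (th (y 0 ord0)), sphere_pt b y)) g p =
  \matrix_(i, j) (a * dth (p 0 ord0) ^+ 2 * (tau i * tau j)
                  + c * (rho p * rho p * del i j)).
Proof.
move=> hg; apply/matrixP => i j; rewrite !mxE hg !partial_time_change.
by rewrite dot_scale dot_circle_tan dot_dsphere_pt; ring.
Qed.

End TimeChange.
End Pullback.

(** * Pseudo-cylindric metrics *)

Lemma powR_split (R : realType) (a b x : R) : 0 < x -> x `^ (a + b) = x `^ a * x `^ b.
Proof. by move=> x0; rewrite powRD //; apply/implyP => _; rewrite gt_eqF. Qed.

Section CylindricODE.
Variables (R : realType) (d : nat) (T : R) (u : R -> R).
Hypothesis d2 : (2 <= d)%N.
Hypothesis T0 : 0 < T.
Hypothesis usol : pseudo_cylindric_sol d.+1 T u.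
Local Notation n := (d.+1%:R : R).
Local Notation u' := (u^`()%classic).

Let u_gt0 t : 0 < u t. Proof. by case: usol => _ + _ _; exact. Qed.
Let u_neq0 t : u t != 0. Proof. by rewrite gt_eqF. Qed.

Lemma dimB2_gt0 : 0 < n - 2.
Proof. by rewrite subr_gt0 ltr_nat. Qed.

Lemma dimB2_neq0 : n - 2 != 0.
Proof. by rewrite gt_eqF // dimB2_gt0. Qed.

Lemma u_smooth : smooth u. Proof. by case: usol. Qed.

Lemma u'_smooth : smooth u'.
Proof. by move=> k; have [_] := Ck_derive1 (u_smooth k.+1). Qed.

Lemma du (t : R) : is_derive t 1 u (u' t).
Proof. by have [h _] := Ck_derive1 (u_smooth 1%N); exact: h. Qed.

(** [conf] is the factor q of dt^2 + dxi^2 and [logd] is psi = q' / (2 q);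
    [logd1] and [logd2] are its first two derivatives, in the form that the
    equation for u gives them. *)
Definition conf t : R := u t `^ (4 / (n - 2)).
Definition logd t : R := 2 / (n - 2) * (u' t / u t).
Definition logd1 t : R := ((n - 2) * (1 - logd t * logd t) - n * conf t) / 2.
Definition logd2 t : R := 2 * logd t * logd1 t
  + (n - 2) * logd t * (logd t * logd t - 1 - logd1 t).

Lemma conf_gt0 t : 0 < conf t. Proof. exact: powR_gt0. Qed.

Lemma u_ode t : u'^`()%classic t =
  (n - 2) ^+ 2 / 4 * u t - n * (n - 2) / 4 * (u t * conf t).
Proof.
case: usol => _ _ _ /(_ t); rewrite /= -/(u'^`()%classic t).
have -> : u t `^ ((n + 2) / (n - 2)) = u t * conf t.
  rewrite -{2}[u t]powRr1 ?(ltW (u_gt0 t)) // /conf -powR_split //.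
  by congr (_ `^ _); have := dimB2_neq0; move: n => m nz; field.
by move=> h; lra.
Qed.

Lemma dconf (t : R) : is_derive t 1 (fun s => conf s) (2 * logd t * conf t).
Proof.
rewrite /conf; notypeclasses refine (is_derive_eq _ _).
  exact: (is_derive_powR _ (u_gt0 t) (du t)).
rewrite powR_split // powR_inv1 ?(ltW (u_gt0 t)) // /logd.
by have := u_neq0 t; have := dimB2_neq0; move: (u t `^ (4 / (n - 2))) (u' t) (u t) n => w y z m nz uz; field; rewrite uz nz.
Qed.

Lemma dlogd (t : R) : is_derive t 1 (fun s => logd s) (logd1 t).
Proof.
have du' : is_derive t 1 u' (u'^`()%classic t).
  by have [h _] := Ck_derive1 (u'_smooth 1%N); exact: h.
rewrite /logd; notypeclasses refine (is_derive_eq _ _).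
  exact: (is_derive_mul (is_derive_const _ _ _)
    (is_derive_mul du' (is_derive_inv (u_neq0 t) (du t)))).
rewrite u_ode /logd1 /logd.
by have := u_neq0 t; have := dimB2_neq0; move: (conf t) (u' t) (u t) n => w y z m nz uz; field; rewrite uz nz.
Qed.

Lemma dlogd1 (t : R) : is_derive t 1 (fun s => logd1 s) (logd2 t).
Proof.
rewrite /logd1; notypeclasses refine (is_derive_eq _ _).
  exact: (is_derive_mul (is_derive_add (is_derive_mul (is_derive_const _ _ _)
    (is_derive_add (is_derive_const _ _ _)
      (is_derive_opp (is_derive_mul (dlogd t) (dlogd t)))))
    (is_derive_opp (is_derive_mul (is_derive_const _ _ _) (dconf t))))
    (is_derive_const _ _ _)).
rewrite /logd2.
have -> : n * (2 * logd t * conf t) =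
  2 * logd t * ((n - 2) * (1 - logd t * logd t) - 2 * logd1 t).
  by rewrite /logd1; field.
by field.
Qed.

Lemma logd_periodic : periodic logd T.
Proof.
have uT : periodic u T by case: usol.
move=> t; rewrite /logd uT; congr (_ * (_ / _)).
have h : is_derive t 1 (fun s => u (s + T)) (u' (t + T) * (1 + 0)).
  exact: (is_derive_comp (du _) (is_derive_add (is_derive_id _ _) (is_derive_const _ _ _))).
move: h; rewrite (_ : (fun s => _) = u); last by apply/funext => s; rewrite uT.
move=> h; rewrite -[LHS]mulr1 -[X in _ * X = _]addr0.
by rewrite -(@derive_val _ _ _ _ _ _ _ h) (@derive_val _ _ _ _ _ _ _ (du t)).
Qed.

(** If psi e = 0 for e = psi^2 - 1 - psi', then e / q = K2 - K1 has derivative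
    zero.  If this constant is not 0, psi vanishes and u is constant.  If it
    is 0, the equation forces psi' = - q, and the mean value theorem on [0, T]
    contradicts the periodicity of psi. *)
Lemma curvature_defect_neq0 : ~ (exists c, forall t, u t = c) ->
  exists t, logd t * (logd t * logd t - 1 - logd1 t) != 0.
Proof.
move=> unc; apply: contrapT => /forallNP noex.
have E0 t : logd t * (logd t * logd t - 1 - logd1 t) = 0.
  by apply/eqP; apply/negPn/negP; exact: noex.
pose e t := logd t * logd t - 1 - logd1 t.
have lE t : logd2 t = 2 * logd t * logd1 t.
  by rewrite /logd2 -[X in _ + X]mulrA E0 mulr0 addr0.
have ce s t : e s / conf s = e t / conf t.
  apply: (is_derive_0_is_cst (f := fun t => e t / conf t)) => {}t.
  have cz : conf t != 0 by rewrite gt_eqF // conf_gt0.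
  rewrite /e; notypeclasses refine (is_derive_eq _ _).
    exact: (is_derive_mul (is_derive_add (is_derive_add
      (is_derive_mul (dlogd t) (dlogd t)) (is_derive_const _ _ _))
      (is_derive_opp (dlogd1 t))) (is_derive_inv cz (dconf t))).
  cbv beta; rewrite lE.
  transitivity (- 2 * (logd t * (logd t * logd t - 1 - logd1 t)) / conf t).
    by field.
  by rewrite E0 mulr0 mul0r.
have [e0|e0] := eqVneq (e 0) 0.
  have ez t : e t = 0.
    have := ce t 0; rewrite e0 mul0r => /eqP.
    by rewrite mulf_eq0 invr_eq0 (gt_eqF (conf_gt0 t)) orbF => /eqP.
  have l1 t : logd1 t = - conf t.
    have := ez t; rewrite /e => h.
    have h1 : logd t * logd t = 1 + logd1 t by lra.
    have : n * (logd1 t + conf t) = 0.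
      by have : logd1 t = _ := erefl; rewrite {1}/logd1 h1 => h2; lra.
    move=> /eqP; rewrite mulf_eq0 pnatr_eq0/= => /eqP; lra.
  have [|c _] := MVT T0 (fun t _ => dlogd t).
    by apply: continuous_subspaceT; exact: (derive1_continuous dlogd).
  rewrite -[X in logd X - _]add0r logd_periodic subrr l1 subr0 => /esym/eqP.
  by rewrite mulf_eq0 oppr_eq0 (gt_eqF (conf_gt0 c)) (gt_eqF T0).
apply: unc; exists (u 0) => t.
apply: (is_derive_0_is_cst (f := u)) => {}t.
have l0 : logd t = 0.
  have := E0 t => /eqP; rewrite mulf_eq0 => /orP[/eqP //|]; rewrite -/(e t) => /eqP et.
  have := ce 0 t; rewrite et mul0r => /eqP.
  by rewrite mulf_eq0 invr_eq0 (gt_eqF (conf_gt0 0)) (negbTE e0).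
have -> : 0 = u' t; last exact: du.
move: l0 => /eqP; rewrite /logd !mulf_eq0 !invr_eq0 (negbTE dimB2_neq0) (negbTE (u_neq0 t)).
by rewrite pnatr_eq0 !orbF /= => /eqP.
Qed.

Lemma pullback_conformal b p : pullback (chart T b) (conformal_metric d.+1 T u) p =
  \matrix_(i, j) (conf (p 0 ord0) * base (@rho R d) i j p).
Proof.
have -> : chart T b = (fun y : 'rV[R]_d.+1 => (circle_pt T (id (y 0 ord0)), sphere_pt b y)).
  by apply/funext => y; rewrite chartE.
rewrite (@pullback_time_change R d T b id (fun=> 1) T0 (fun t => is_derive_id t 1) _ p
   (conf (p 0 ord0)) (conf (p 0 ord0))).
  by apply/matrixP => i j; rewrite !mxE /base expr1n mulr1 -mulrDr.
move=> v w; rewrite /conformal_metric /product_metric /warped_metric !mul1r mulrDr.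
have uT : periodic u T by case: usol.
by rewrite /= (periodic_arc T0 _ uT).
Qed.

(** Functions of t as functions on the coordinate space. *)
Definition at_t (f : R -> R) (p : 'rV[R]_d.+1) : R := f (p 0 ord0).

Lemma d_at_t (f df : R -> R) : (forall t : R, is_derive t 1 f (df t)) ->
  forall p i, is_derive p (delta_mx 0 i) (at_t f) (at_t df p * tau R i).
Proof.
move=> h p i; notypeclasses refine (is_derive_eq _ _).
  exact: (is_derive_comp (h _) (is_derive_coord _ _ _)).
by rewrite mxE/= -/(kap R ord0 i) kap0l.
Qed.

Section InChart.
Variable b : bool.
Local Notation G := (pullback (chart T b) (conformal_metric d.+1 T u)).

Let GE p i j : G p i j = at_t conf p * base (@rho R d) i j p.
Proof. by rewrite pullback_conformal mxE. Qed.

Let conf_neq0 p : at_t conf p != 0. Proof. by rewrite gt_eqF // conf_gt0. Qed.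
Let rho_neq0 (p : 'rV[R]_d.+1) : rho p != 0. Proof. by rewrite gt_eqF // rho_gt0. Qed.

Lemma div_conformal k i j p : div_riemann G k i j p = 0.
Proof.
rewrite (div_riemannE (q := at_t conf) (psi := at_t logd) (psi1 := at_t logd1)
  (psi2 := at_t logd2) conf_neq0 rho_neq0 (@sig0 R d) (@sum_sig2 R d)
  (d_at_t dconf) (d_at_t dlogd) (d_at_t dlogd1) (@drho R d) (@dsig R d) GE).
by rewrite /at_t /logd2; ring.
Qed.

Lemma cov_ricci_conformal k p : k != ord0 -> cov_ricci G k k ord0 p =
  (n - 2) * (at_t logd p * (at_t logd p * at_t logd p - 1 - at_t logd1 p)) * rho p ^+ 2.
Proof.
move=> k0.
rewrite (cov_ricci_mixed (q := at_t conf) (psi := at_t logd) (psi1 := at_t logd1)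
   conf_neq0 rho_neq0 (@sig0 R d) (@sum_sig2 R d)
  (d_at_t dconf) (d_at_t dlogd) (@drho R d) (@dsig R d) GE) //.
by ring.
Qed.

End InChart.

Lemma harmonic_conformal : harmonic_curvature T (conformal_metric d.+1 T u).
Proof. by move=> b k i j p; exact: div_conformal. Qed.

Lemma not_parallel_conformal : ~ (exists c, forall t, u t = c) ->
  ~ parallel_ricci T (conformal_metric d.+1 T u).
Proof.
move=> /curvature_defect_neq0[t /negP tn] par; apply: tn.
pose k : 'I_d.+1 := Ordinal (ltnW d2 : (1 < d.+1)%N).
have := par true k k ord0 (const_mx t); rewrite cov_ricci_conformal // /at_t mxE.
move=> /eqP; rewrite mulf_eq0 expf_eq0 mulf_eq0 (negbTE dimB2_neq0) /=.
by rewrite (gt_eqF (rho_gt0 _)) orbF => ->.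
Qed.

End CylindricODE.

(** * Arc length and its inverse *)

Section Primitive.
Variables (R : realType) (f : R -> R).
Hypothesis cf : continuous f.
Notation mu := (@lebesgue_measure R).
Implicit Types a b x : R.

Let I a x := (\int[mu]_(t in [set` `[a, x]]) f t).
Let J a x := (\int[mu]_(t in [set` `]a, x]]) f t).

Let integ a b : mu.-integrable [set` `[a, b]] (EFin \o f).
Proof.
apply: continuous_compact_integrable; first exact: segment_compact.
exact: continuous_subspaceT.
Qed.

Let IB a b x : a <= b -> b <= x -> I a x - I a b = J b x.
Proof. by move=> ab bx; apply: Rintegral_itvB. Qed.

Let I_indep a b x : a <= b -> b <= x -> b <= 0 ->
  I a x - I a 0 = I b x - I b 0.
Proof.
move=> ab bx b0.
have := IB ab bx; have := IB ab b0; have := IB (lexx b) bx.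
have := IB (lexx b) b0; lra.
Qed.

(** Integrals over [a, x] only give a primitive to the right of a.  Let a depend
    on x: the difference of the integrals up to x and up to 0 does not depend
    on a ([I_indep]), so that near each point a may be taken fixed. *)
Lemma continuous_primitive : exists F : R -> R, forall x : R, is_derive x 1 F (f x).
Proof.
pose F x := I (- `|x| - 1) x - I (- `|x| - 1) 0.
exists F => x; pose M := `|x| + 2.
have D : is_derive x 1 (fun y => I (- M) y - I (- M) 0) (f x).
  have Mx : - M < x.
    by rewrite /M; have := ler_norm (- x); rewrite normrN; lra.
  have xx : x < x + 1 by rewrite ltrDl.
  have [D1 D2] := @continuous_FTC1_closed R f (- M) x (x + 1)
     xx (@integ _ _) Mx (cf (x:=x)).
  notypeclasses refine (is_derive_eq _ (subr0 _)).
  notypeclasses refine (is_derive_add _ (is_derive_opp (is_derive_const _ _ _))).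
  by split; [exact: D1 | rewrite -derive1E; exact: D2].
apply: (near_eq_is_derive _ D).
near=> y; rewrite /F; apply: I_indep.
- rewrite /M; suff : `|y| < `|x| + 1 by lra.
  have : `|x - y| < 1.
    by near: y; apply/nbhs_ballP; exists 1 => //= y.
  have := ler_normD (y - x) x; rewrite subrK distrC; lra.
- by have := ler_norm (- y); rewrite normrN; lra.
- by have := normr_ge0 y; lra.
Unshelve. all: by end_near. Qed.

End Primitive.

Section Inversion.
Variables (R : realType) (T : R) (w : R -> R).
Hypothesis T0 : 0 < T.
Hypothesis w_smooth : smooth w.
Hypothesis w_gt0 : forall t, 0 < w t.
Hypothesis wT : periodic w T.

(** P is a primitive of w and th its inverse.  Surjectivity of P comes from the
    intermediate value theorem on [k T, (k+1) T], whose image is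
    [P 0 + k S, P 0 + (k+1) S]; smoothness of th comes from th' = 1 / w(th) by
    induction on the order of differentiability. *)
Lemma periodic_inversion : exists (S : R) (P th : R -> R),
  [/\ 0 < S, smooth P, smooth th &
   [/\ forall s : R, is_derive s 1 th (w (th s))^-1,
       cancel P th, cancel th P,
       forall t, P (t + T) = P t + S & forall s, th (s + S) = th s + T]].
Proof.
have [P dP] := continuous_primitive (w_smooth 0%N : continuous w).
have cP : continuous P := derive1_continuous dP.
have incP x y : x < y -> P x < P y.
  move=> xy; have [|c _ E] := MVT xy (fun t _ => dP t).
    exact: continuous_subspaceT.
  by rewrite -subr_gt0 E mulr_gt0 // subr_gt0.
have injP x y : P x = P y -> x = y.
  by case: (ltgtP x y) => // /incP + E; rewrite E ltxx.
pose S := P T - P 0.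
have S0 : 0 < S by rewrite subr_gt0 incP.
have PT t : P (t + T) = P t + S.
  have dD (s : R) : is_derive s 1 (fun s => P (s + T) - P s) 0.
    notypeclasses refine (is_derive_eq _ _).
      exact: (is_derive_add (is_derive_comp (dP _)
        (is_derive_add (is_derive_id _ _) (is_derive_const _ _ _)))
        (is_derive_opp (dP s))).
    by cbv beta; rewrite wT addr0 mulr1 subrr.
  have := is_derive_0_is_cst t 0 dD.
  by rewrite add0r => E; rewrite /S -[P T - P 0]E; ring.
have PTk t (k : int) : P (t + k%:~R * T) = P t + k%:~R * S.
  (* Subtracting the linear part makes P periodic. *)
  have per : periodic (fun s => P s - s * (S / T)) T.
    move=> s; rewrite PT; field; rewrite gt_eqF //.
  have := periodic_int t k per => /= h.
  have : P (t + k%:~R * T) = P t + (t + k%:~R * T) * (S / T) - t * (S / T) by lra.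
  move=> ->; field; rewrite gt_eqF //.
have surjP s : exists t, P t = s.
  pose k := Num.floor ((s - P 0) / S).
  have /andP[k1 k2] := floor_itv ((s - P 0) / S).
  have [|||c _ Pc] := @IVT R P (0 + k%:~R * T) (0 + (k + 1)%:~R * T) s.
  - by rewrite !add0r ler_pM2r // ler_int lerDl.
  - exact: continuous_subspaceT.
  - rewrite !PTk.
    have h1 : P 0 + k%:~R * S <= s by rewrite -lerBrDl -ler_pdivlMr.
    have h2 : s <= P 0 + (k + 1)%:~R * S.
      by rewrite -lerBlDl -ler_pdivrMr // ltW.
    by rewrite ge_min le_max h1 h2 orbT.
  - by exists c.
pose th s := xget 0 [set t | P t = s].
have thK : cancel th P.
  move=> s; rewrite /th; have [t ts] := surjP s.
  by case: xgetP => [x _ //|/(_ t)]; rewrite /= ts.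
have PK : cancel P th by move=> t; apply: injP; rewrite thK.
have dth (s : R) : is_derive s 1 th (w (th s))^-1.
  rewrite -{1}(thK s); apply: (is_derive_inverse (f := P)) => //.
  - by near=> y; exact: PK.
  - by near=> y; exact: cP.
  - by rewrite gt_eqF.
exists S, P, th; split => //.
- move=> [|k]; first exact: cP.
  by apply: (Ck_real (df := w)) => //; exact: w_smooth.
- move=> k; elim: k => [|k IH]; first exact: (derive1_continuous dth).
  apply: (Ck_real (df := fun s => (w (th s))^-1)) => //.
  apply: (Ck_inv (f := fun s => w (th s))) => //.
  by apply: (Ck_comp (f := w)).
- by split => // s; rewrite -[in LHS](thK s) -PT PK.
Unshelve. all: by end_near. Qed.

End Inversion.

Lemma Ck_circle_pt (R : realType) (V : normedModType R) k (T : R) (g : V -> R) :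
  Ck k g -> Ck k (fun y => circle_pt T (g y)).
Proof.
move=> Cg; apply: Ck_row => i; apply: Ck_mul; first exact: Ck_cst.
have [Cs Cc] := Ck_sin_cos R k.
have CL : Ck k (fun y => 2 * pi * g y / T).
  apply: Ck_mul; last exact: Ck_cst.
  by apply: Ck_mul => //; exact: Ck_cst.
by case: eqP => _; [apply: (Ck_comp Cc CL) | apply: (Ck_comp Cs CL)].
Qed.

Lemma Ck_sphere_pt (R : realType) d k b :
  Ck k (fun y : 'rV[R]_d.+1 => sphere_pt b y).
Proof.
have Cf j : Ck k (fun y : 'rV[R]_d.+1 => fibre j y).
  apply: Ck_add; first exact: Ck_coord.
  by apply: Ck_opp; apply: Ck_mul; [exact: Ck_cst | exact: Ck_coord].
have Cr : Ck k (fun y : 'rV[R]_d.+1 => rho y).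
  apply: Ck_mul; first exact: Ck_cst.
  apply: (Ck_inv (f := @stereo_den R d)); first exact: stereo_den_gt0.
  apply: Ck_add; first exact: Ck_cst.
  by apply: Ck_sum => j; exact: Ck_mul.
apply: Ck_row => j; apply: Ck_add; last exact: Ck_mul.
apply: Ck_mul; first exact: Ck_cst.
apply: Ck_add; first exact: Ck_cst.
exact: Ck_opp.
Qed.

(** * The conformal diffeomorphism *)

Section TimeChangeMap.
Variables (R : realType) (d : nat).
Local Notation amb := ('rV[R]_2 * 'rV[R]_d.+1)%type.
Implicit Types (S T : R) (th : R -> R).

(** The map of circles induced by th, times the identity of the sphere.  [arc]
    chooses a coordinate modulo S, so that this is meaningful when
    th (s + S) = th s + T ([circle_map_pt]). *)
Definition circle_map S T th (q : amb) : amb := (circle_pt T (th (arc S q.1)), q.2).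

Section OneMap.
Variables (S T : R) (th : R -> R).
Hypothesis S0 : 0 < S.
Hypothesis T0 : 0 < T.
Hypothesis thS : forall s, th (s + S) = th s + T.

Lemma equivariant_int s (k : int) : th (s + k%:~R * S) = th s + k%:~R * T.
Proof.
have Sn : S != 0 by rewrite gt_eqF.
(* Subtracting the linear part makes th periodic. *)
have per : periodic (fun s => th s - s * (T / S)) S.
  by move=> {}s; rewrite thS; field.
have := periodic_int s k per => /= h.
have -> : th (s + k%:~R * S) = th s + (s + k%:~R * S) * (T / S) - s * (T / S) by lra.
by field.
Qed.

Lemma circle_map_pt s y :
  circle_map S T th (circle_pt S s, y) = (circle_pt T (th s), y).
Proof.
rewrite /circle_map/=; have [k ->] := arc_circle_pt S0 s.
by rewrite equivariant_int circle_pt_periodic.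
Qed.

Lemma circle_map_chart b : circle_map S T th \o chart S b =
  (fun p : 'rV[R]_d.+1 => (circle_pt T (th (p 0 ord0)), sphere_pt b p)).
Proof. by apply/funext => p; rewrite /= chartE circle_map_pt. Qed.

Lemma circle_map_set_fun :
  set_fun (@circle_sphere R d S) (@circle_sphere R d T) (circle_map S T th).
Proof. by move=> q [_ q2]; split => //=; rewrite dot_circle_pt. Qed.

Lemma circle_map_smooth : smooth th -> smooth_on S (circle_map S T th).
Proof.
move=> th_smooth b k; rewrite circle_map_chart; apply: Ck_pair.
  apply: Ck_circle_pt; apply: (Ck_comp (f := th)); first exact: th_smooth.
  exact: Ck_coord.
exact: Ck_sphere_pt.
Qed.

End OneMap.

Lemma circle_map_cancel S T th P : 0 < S -> 0 < T ->
  (forall t, P (t + T) = P t + S) -> cancel th P ->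
  {in @circle_sphere R d S, cancel (circle_map S T th) (circle_map T S P)}.
Proof.
move=> S0 T0 PT thK q /set_mem[q1 q2].
rewrite {2}/circle_map circle_map_pt // thK arcK //.
by case: q q1 q2.
Qed.

Lemma circle_map_diffeo S T th P : 0 < S -> 0 < T ->
  (forall s, th (s + S) = th s + T) -> (forall t, P (t + T) = P t + S) ->
  cancel th P -> cancel P th -> smooth th -> smooth P ->
  diffeo S T (circle_map S T th).
Proof.
move=> S0 T0 thS PT thK PK th_smooth P_smooth; exists (circle_map T S P).
split; [exact: circle_map_set_fun | exact: circle_map_set_fun | | |].
- by split; exact: circle_map_cancel.
- exact: circle_map_smooth.
- exact: circle_map_smooth.
Qed.

End TimeChangeMap.

(** * Derdzinski metrics *)

Section Derdzinski.
Variables (R : realType) (d : nat) (T : R) (u : R -> R).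
Hypothesis d2 : (2 <= d)%N.
Hypothesis T0 : 0 < T.
Hypothesis usol : pseudo_cylindric_sol d.+1 T u.
Local Notation n := (d.+1%:R : R).
Local Notation u' := (u^`()%classic).

Let u_gt0 t : 0 < u t. Proof. by case: usol => _ + _ _; exact. Qed.
Let nB2 : n - 2 != 0. Proof. exact: dimB2_neq0. Qed.
Let n0 : n != 0. Proof. by rewrite pnatr_eq0. Qed.

(** The square root of [conf]: the radius of the sphere at t, and the speed of
    the arc length. *)
Definition warp t : R := u t `^ (2 / (n - 2)).

Lemma warp_gt0 t : 0 < warp t. Proof. exact: powR_gt0. Qed.

Lemma confE t : conf d u t = warp t ^+ 2.
Proof.
rewrite /conf /warp expr2 -powR_split //; congr (_ `^ _).
by move: n nB2 => m nz; field.
Qed.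

Lemma warp_smooth : smooth warp.
Proof. by move=> k; apply: Ck_powR => //; case: usol => + _ _ _; exact. Qed.

Variables (S : R) (th : R -> R).
Hypothesis th_smooth : smooth th.
Hypothesis dth : forall s : R, is_derive s 1 th (warp (th s))^-1.
Hypothesis S0 : 0 < S.
Hypothesis thS : forall s, th (s + S) = th s + T.

Definition hsol s : R := u (th s) `^ (n / (n - 2)).

Lemma hsolE s : hsol s = u (th s) * warp (th s).
Proof.
rewrite /hsol /warp -{2}[u (th s)]powRr1 ?(ltW (u_gt0 _)) // -powR_split //.
by congr (_ `^ _); move: n nB2 => m nz; field.
Qed.

Lemma hsol_warp s : hsol s `^ (2 / n) = warp (th s).
Proof.
rewrite /hsol -powRrM; congr (_ `^ _).
by move: n nB2 n0 => m nz mz; field; rewrite nz mz.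
Qed.

Lemma hsol_pow s : hsol s `^ (1 - 4 / n) = u (th s) / warp (th s).
Proof.
rewrite /hsol /warp -powRrM -powRN -{2}[u (th s)]powRr1 ?(ltW (u_gt0 _)) // -powR_split //.
by congr (_ `^ _); move: n nB2 n0 => m nz mz; field; rewrite nz mz.
Qed.

(** The exponent n/(n-2) is the one for which the factor u^(2/(n-2)) of the
    derivative of the power cancels th' = u^(-2/(n-2)). *)
Lemma dhsol (s : R) : is_derive s 1 hsol (n / (n - 2) * u' (th s)).
Proof.
notypeclasses refine (is_derive_eq _ _).
  exact: (is_derive_powR _ (u_gt0 _) (is_derive_comp (du usol _) (dth s))).
have -> : n / (n - 2) - 1 = 2 / (n - 2) by move: n nB2 => m nz; field.
rewrite -/(warp (th s)).
have := warp_gt0 (th s); rewrite lt0r => /andP[wz _].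
by move: n nB2 (warp (th s)) (u' (th s)) wz => m nz w y wz; field; rewrite nz wz.
Qed.

Lemma hsol_derdzinski : derdzinski_sol d.+1 S hsol.
Proof.
have uT : periodic u T by case: usol.
split.
- move=> k; apply: Ck_powR => [s|]; first exact: u_gt0.
  by apply: (Ck_comp (f := u)); [case: usol => + _ _ _; exact | exact: th_smooth].
- by move=> s; exact: powR_gt0.
- by move=> s; rewrite /hsol thS uT.
exists n; first by rewrite ltr0n.
move=> s; rewrite /= (_ : hsol^`()%classic = (fun s => n / (n - 2) * u' (th s))); last first.
  apply/funext => t; rewrite derive1E.
  exact: (@derive_val _ _ _ _ _ _ _ (dhsol t)).
have du' (t : R) : is_derive t 1 u' (u'^`()%classic t).
  by have [h _] := Ck_derive1 (u'_smooth usol 1%N); exact: h.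
rewrite derive1E (@derive_val _ _ _ _ _ _ _ (is_derive_mul
  (is_derive_const (n / (n - 2)) s 1) (is_derive_comp (du' _) (dth s)))).
rewrite (u_ode d2 usol) hsol_pow hsolE confE /sphere_scal.
have := warp_gt0 (th s); rewrite lt0r => /andP[wz _].
have n1 : n - 1 != 0 by rewrite -natr1 addrK pnatr_eq0 -lt0n ltnW.
cbv beta; move: n nB2 n0 n1 (warp (th s)) (u (th s)) (u' (th s)) wz.
by move=> m nz mz m1 w x y wz; field; rewrite nz wz m1.
Qed.

Let metric_at s y v w : derdzinski_metric d.+1 S hsol (circle_pt S s, y) v w =
  dot v.1 w.1 + warp (th s) ^+ 2 * dot v.2 w.2.
Proof.
rewrite /derdzinski_metric /warped_metric/= mul1r; congr (_ + _ * _).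
have per : periodic (fun s => (hsol s `^ (2 / n)) ^+ 2) S.
  by case: hsol_derdzinski => _ _ hS _ {}s; rewrite hS.
by rewrite (periodic_arc S0 _ per) hsol_warp.
Qed.

Let th_pullback (g : metric R d) b p (a c : R) :=
  @pullback_time_change R d T b th _ T0 dth g p a c.

Let id_pullback (g : metric R d) b p (a c : R) :=
  @pullback_time_change R d S b id (fun=> 1) S0 (fun t => is_derive_id t 1) g p a c.

(** The conformal factor is 1/f^2: F^*(dt^2 + dxi^2) = f^(-2) (ds^2 + f^2 dxi^2),
    as dt = ds / f. *)
Lemma circle_map_conformal :
  conformal S (circle_map S T th) (derdzinski_metric d.+1 S hsol) (product_metric T).
Proof.
pose lam (q : 'rV[R]_2 * 'rV[R]_d.+1) := (warp (th (arc S q.1)) * warp (th (arc S q.1)))^-1.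
have lamE s y : lam (circle_pt S s, y) = (warp (th s) * warp (th s))^-1.
  have per : periodic (fun s => (warp (th s) * warp (th s))^-1) S.
    by move=> {}s; rewrite thS /warp; case: usol => _ _ -> _.
  exact: (periodic_arc S0 s per).
exists lam; split.
- by move=> q _; rewrite invr_gt0 mulr_gt0 ?warp_gt0.
- move=> b k.
  have -> : lam \o chart S b = (fun p : 'rV[R]_d.+1 =>
      (warp (th (p 0 ord0)) * warp (th (p 0 ord0)))^-1).
    by apply/funext => p; rewrite /= chartE lamE.
  have C : Ck k (fun p : 'rV[R]_d.+1 => warp (th (p 0 ord0))).
    apply: (Ck_comp (f := warp) (g := fun p : 'rV[R]_d.+1 => th (p 0 ord0))).
      exact: warp_smooth.
    by apply: (Ck_comp (f := th)); [exact: th_smooth | exact: Ck_coord].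
  apply: (Ck_inv (f := fun p : 'rV[R]_d.+1 => warp (th (p 0 ord0)) * warp (th (p 0 ord0)))).
    by move=> p; rewrite mulr_gt0 ?warp_gt0.
  exact: Ck_mul.
move=> b p; rewrite circle_map_chart // (th_pullback (a := 1) (c := 1)); last first.
  by move=> v w; rewrite /product_metric /warped_metric.
rewrite (_ : chart S b = fun p => (circle_pt S (id (p 0 ord0)), sphere_pt b p)); last first.
  by apply/funext => y; rewrite chartE.
rewrite (id_pullback (a := (warp (th (p 0 ord0)) ^+ 2)^-1) (c := 1)).
  apply/matrixP => i j; rewrite !mxE.
  by rewrite expr1n !mul1r mulr1 exprVn.
move=> v w; rewrite metric_at lamE -expr2 mulrDr mulrA mulVf ?mul1r //.
by rewrite expf_neq0 // gt_eqF // warp_gt0.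
Qed.

Lemma circle_map_isometry :
  is_pullback S (circle_map S T th) (conformal_metric d.+1 T u)
    (derdzinski_metric d.+1 S hsol).
Proof.
move=> b p; rewrite circle_map_chart //.
rewrite (th_pullback (a := warp (th (p 0 ord0)) ^+ 2)
  (c := warp (th (p 0 ord0)) ^+ 2)); last first.
  move=> v w; rewrite /conformal_metric /product_metric /warped_metric !mul1r mulrDr.
  have uT : periodic u T by case: usol.
  by rewrite /= (periodic_arc T0 _ uT) -/(conf d u _) confE.
rewrite (_ : chart S b = fun p => (circle_pt S (id (p 0 ord0)), sphere_pt b p)); last first.
  by apply/funext => y; rewrite chartE.
rewrite (id_pullback (a := 1) (c := warp (th (p 0 ord0)) ^+ 2)).
  apply/matrixP => i j; rewrite !mxE.
  rewrite expr1n mul1r exprVn mulfV //.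
  by rewrite expf_neq0 // gt_eqF // warp_gt0.
by move=> v w; rewrite metric_at mul1r.
Qed.

End Derdzinski.

Theorem mainTheorem2 (R : realType) (n : nat) (T : R)
    (hn : (3 <= n)%N) (hT : 0 < T) :
  (2 * pi / Num.sqrt (n%:R - 2) <= T ->
   forall u : R -> R, pseudo_cylindric_sol n T u ->
     ~ (exists c, forall t, u t = c) ->
     harmonic_curvature T (conformal_metric n T u) /\
     ~ parallel_ricci T (conformal_metric n T u)) /\
  (forall u : R -> R, pseudo_cylindric_sol n T u ->
     exists (S : R) (h : R -> R)
       (F : 'rV[R]_2 * 'rV[R]_n.-1.+1 -> 'rV[R]_2 * 'rV[R]_n.-1.+1),
       [/\ 0 < S,
           derdzinski_sol n S h,
           diffeo S T F,
           conformal S F (derdzinski_metric n S h) (product_metric T)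
         & is_pullback S F (conformal_metric n T u)
             (derdzinski_metric n S h)]).
Proof.
case: n hn => [//|d] hd; have d2 : (2 <= d)%N by [].
split=> [_ u usol unc | u usol].
  by split; [exact: harmonic_conformal | exact: not_parallel_conformal].
have wT : periodic (warp d u) T by case: usol => _ _ uT _ t; rewrite /warp uT.
have [S [P [th [S0 Psm thsm [dth PK thK PT thS]]]]] :=
  periodic_inversion hT (warp_smooth usol) (warp_gt0 usol) wT.
exists S, (hsol d u th), (@circle_map R d S T th); split => //.
- exact: (hsol_derdzinski d2 usol thsm dth thS).
- exact: (circle_map_diffeo d S0 hT thS PT thK PK thsm Psm).
- exact: circle_map_conformal.
- exact: circle_map_isometry.
Qed.
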